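(* Let $M,N$ be complete pointed metric spaces and let $f\colon M\to N$ be a Lipschitz map with $f(0_M)=0_N$. The following are equivalent: (1) $\widehat f\colon\mathcal F(M)\to\mathcal F(N)$ is compact; (2) $\widehat f\colon\mathcal F(M)\to\mathcal F(N)$ is weakly compact; (3) $C_f\colon\mathrm{Lip}_0(N)\to\mathrm{Lip}_0(M)$ is compact; (4) $C_f\colon\mathrm{Lip}_0(N)\to\mathrm{Lip}_0(M)$ is weakly compact; (5) $C_f\colon\mathrm{Lip}_0(N)\to\mathrm{Lip}_0(M)$ is weak$^*$-to-weak continuous.
   Context: Scalars are $\mathbb K=\mathbb R$ or $\mathbb C$. For a pointed metric space $(M,d,0_M)$, $\mathrm{Lip}_0(M)$ denotes the Banach space of Lipschitz functions $g\colon M\to\mathbb K$ with $g(0_M)=0$, normed by the best Lipschitz constant. For $x\in M$, $\delta(x)\in\mathrm{Lip}_0(M)^*$ is evaluation at $x$. The Lipschitz-free space $\mathcal F(M)$ is the norm-closed linear span of $\{\delta(x):x\in M\}$ in $\mathrm{Lip}_0(M)^*$; its dual is isometrically $\mathrm{Lip}_0(M)$ (this gives the weak$^*$ topology on $\mathrm{Lip}_0(M)$). For a Lipschitz map $f\colon M\to N$ with $f(0_M)=0_N$, $\widehat f\colon\mathcal F(M)\to\mathcal F(N)$ is the unique bounded linear operator with $\widehat f(\delta(x))=\delta(f(x))$, and $C_f\colon \mathrm{Lip}_0(N)\to\mathrm{Lip}_0(M)$, $C_f(g)=g\circ f$, is the composition operator (the adjoint of $\widehat f$). An operator is weakly compact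 if the image of the unit ball is relatively weakly compact. *)

(* Defs.v *)
From mathcomp Require Import all_boot all_order all_algebra.
From mathcomp Require Import reals.
From mathcomp Require Import complex.
Set Implicit Arguments. Unset Strict Implicit. Unset Printing Implicit Defensive.
Import Order.TTheory GRing.Theory Num.Theory.
Local Open Scope ring_scope.

Section LipFree.
(* R : the reals; K : the scalar field; emb : R -> K the canonical embedding
   (identity for K = R, r |-> r%:C for K = C).  Distances and norms are
   real numbers, compared with moduli in K through emb. *)
Variables (R : realType) (K : numFieldType) (emb : R -> K).

Definition is_metric (M : Type) (d : M -> M -> R) : Prop :=
  [/\ forall x y, 0 <= d x y,
      forall x y, d x y = 0 <-> x = y,
      forall x y, d x y = d y x
    & forall x y z, d x z <= d x y + d y z].

Definition complete_metric (M : Type) (d : M -> M -> R) : Prop :=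
  forall u : nat -> M,
    (forall e : R, 0 < e -> exists n0, forall m n, (n0 <= m)%N -> (n0 <= n)%N ->
         d (u m) (u n) < e) ->
    exists l : M, forall e : R, 0 < e -> exists n0, forall n, (n0 <= n)%N ->
         d (u n) l < e.

Definition lipschitz_map (M N : Type) (dM : M -> M -> R) (dN : N -> N -> R)
  (f : M -> N) : Prop :=
  exists L : R, forall x y, dN (f x) (f y) <= L * dM x y.

Definition lip_le (M : Type) (d : M -> M -> R) (g : M -> K) (c : R) : Prop :=
  forall x y, `|g x - g y| <= emb (c * d x y).

Definition Lip0 (M : Type) (d : M -> M -> R) (x0 : M) (g : M -> K) : Prop :=
  g x0 = 0 /\ exists c : R, lip_le d g c.

(* functionals on Lip_0(M), represented as maps (M -> K) -> K; only their
   values on Lip_0(M) matter *)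
Definition delta (M : Type) (x : M) : (M -> K) -> K := fun g => g x.

Definition dual_le (M : Type) (d : M -> M -> R) (x0 : M)
  (phi : (M -> K) -> K) (c : R) : Prop :=
  forall g, Lip0 d x0 g -> lip_le d g 1 -> `|phi g| <= emb c.

Definition in_dual (M : Type) (d : M -> M -> R) (x0 : M)
  (phi : (M -> K) -> K) : Prop :=
  (forall (a : K) g h, Lip0 d x0 g -> Lip0 d x0 h ->
      phi (fun t => a * g t + h t) = a * phi g + phi h)
  /\ exists c : R, dual_le d x0 phi c.

Definition in_span_delta (M : Type) (psi : (M -> K) -> K) : Prop :=
  exists n (a : 'I_n -> K) (x : 'I_n -> M),
    psi = fun g => \sum_(i < n) a i * delta (x i) g.

Definition in_free (M : Type) (d : M -> M -> R) (x0 : M)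
  (phi : (M -> K) -> K) : Prop :=
  in_dual d x0 phi /\
  forall e : R, 0 < e -> exists psi, in_span_delta psi /\
    dual_le d x0 (fun g => phi g - psi g) e.

(* open sets are relative to the carrier S: only points of S matter *)
Definition closure_in (T : Type) (S : T -> Prop) (op : (T -> Prop) -> Prop)
  (A : T -> Prop) : T -> Prop :=
  fun x => S x /\ forall U, op U -> U x -> exists y, A y /\ U y.

Definition compact_in (T : Type) (op : (T -> Prop) -> Prop) (C : T -> Prop) : Prop :=
  forall (I : Type) (U : I -> T -> Prop), (forall i, op (U i)) ->
    (forall x, C x -> exists i, U i x) ->
    exists n (j : 'I_n -> I), forall x, C x -> exists k, U (j k) x.

Definition rel_compact_in (T : Type) (S : T -> Prop) (op : (T -> Prop) -> Prop)
  (A : T -> Prop) : Prop := compact_in op (closure_in S op A).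

(* A normed space is given by a carrier S (a linear subspace of X -> K)
   and nb v c  <->  ||v|| <= c *)
Definition norm_open (X : Type) (S : (X -> K) -> Prop)
  (nb : (X -> K) -> R -> Prop) (U : (X -> K) -> Prop) : Prop :=
  forall v, S v -> U v -> exists e : R, 0 < e /\
    forall w, S w -> nb (fun t => w t - v t) e -> U w.

Definition cont_lin_functional (X : Type) (S : (X -> K) -> Prop)
  (nb : (X -> K) -> R -> Prop) (L : (X -> K) -> K) : Prop :=
  (forall (a : K) v w, S v -> S w ->
      L (fun t => a * v t + w t) = a * L v + L w)
  /\ exists C : R, forall v c, S v -> nb v c -> `|L v| <= emb (C * c).

Definition weak_open (X : Type) (S : (X -> K) -> Prop)
  (nb : (X -> K) -> R -> Prop) (U : (X -> K) -> Prop) : Prop :=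
  forall v, S v -> U v -> exists n (L : 'I_n -> (X -> K) -> K) (e : R),
    0 < e /\ (forall i, cont_lin_functional S nb (L i)) /\
    forall w, S w -> (forall i, `|L i w - L i v| < emb e) -> U w.

Definition image_ball (X Y : Type) (S : (X -> K) -> Prop)
  (nb : (X -> K) -> R -> Prop) (T : (X -> K) -> (Y -> K)) : (Y -> K) -> Prop :=
  fun w => exists v, S v /\ nb v 1 /\ w = T v.

Definition compact_op (X Y : Type) (S1 : (X -> K) -> Prop)
  (nb1 : (X -> K) -> R -> Prop) (S2 : (Y -> K) -> Prop)
  (nb2 : (Y -> K) -> R -> Prop) (T : (X -> K) -> (Y -> K)) : Prop :=
  rel_compact_in S2 (norm_open S2 nb2) (image_ball S1 nb1 T).

Definition weakly_compact_op (X Y : Type) (S1 : (X -> K) -> Prop)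
  (nb1 : (X -> K) -> R -> Prop) (S2 : (Y -> K) -> Prop)
  (nb2 : (Y -> K) -> R -> Prop) (T : (X -> K) -> (Y -> K)) : Prop :=
  rel_compact_in S2 (weak_open S2 nb2) (image_ball S1 nb1 T).

Definition LipS (M : Type) (d : M -> M -> R) (x0 : M) := Lip0 d x0.
Definition LipNb (M : Type) (d : M -> M -> R) : (M -> K) -> R -> Prop :=
  fun g c => lip_le d g c.
Definition FreeS (M : Type) (d : M -> M -> R) (x0 : M) := in_free d x0.
Definition FreeNb (M : Type) (d : M -> M -> R) (x0 : M)
  : ((M -> K) -> K) -> R -> Prop := fun phi c => dual_le d x0 phi c.

(* weak^* topology on Lip_0(M) = F(M)^* *)
Definition weakstar_open (M : Type) (d : M -> M -> R) (x0 : M)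
  (U : (M -> K) -> Prop) : Prop :=
  forall g, Lip0 d x0 g -> U g -> exists n (phi : 'I_n -> (M -> K) -> K) (e : R),
    0 < e /\ (forall i, in_free d x0 (phi i)) /\
    forall h, Lip0 d x0 h -> (forall i, `|phi i h - phi i g| < emb e) -> U h.

Definition Cf (M N : Type) (f : M -> N) : (N -> K) -> (M -> K) :=
  fun g => fun x => g (f x).

(* fhat = the linearization of f : F(M) -> F(N); it is the restriction of
   the adjoint of C_f, i.e. fhat(phi) = phi o C_f, so fhat(delta x) = delta (f x) *)
Definition fhat (M N : Type) (f : M -> N) : ((M -> K) -> K) -> ((N -> K) -> K) :=
  fun phi => fun h => phi (Cf f h).

Definition lipfree_tfae (M N : Type) (dM : M -> M -> R) (xM : M)
  (dN : N -> N -> R) (xN : N) (f : M -> N) : Prop :=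
  [<-> compact_op (FreeS dM xM) (FreeNb dM xM) (FreeS dN xN) (FreeNb dN xN) (fhat f);
       weakly_compact_op (FreeS dM xM) (FreeNb dM xM) (FreeS dN xN) (FreeNb dN xN) (fhat f);
       compact_op (LipS dN xN) (@LipNb N dN) (LipS dM xM) (@LipNb M dM) (Cf f);
       weakly_compact_op (LipS dN xN) (@LipNb N dN) (LipS dM xM) (@LipNb M dM) (Cf f);
       forall U, weak_open (LipS dM xM) (@LipNb M dM) U ->
         weakstar_open dN xN (fun g => U (Cf f g))].

End LipFree.

(* Main.v *)
Require Import Defs.
From Stdlib Require List.
From mathcomp Require Import all_boot all_order all_algebra.
From mathcomp Require Import boolp classical_sets filter.
From mathcomp Require Import reals complex.
From mathcomp Require Import ring lra.
Set Implicit Arguments. Unset Strict Implicit. Unset Printing Implicit Defensive.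
Import Order.TTheory GRing.Theory Num.Theory.
Local Open Scope classical_set_scope.
Local Open Scope ring_scope.

(** Everything is equivalent to a metric condition on [f], [finitely_flat]: for
    each [e > 0] there is a finite set [F] such that for all [x, y] either
    [d (f x) (f y) <= e * d x y] or both [f x] and [f y] lie within
    [e * d x y] of [F].

    If it fails, greedy selection and Ramsey's theorem yield pairs
    [(p_m, q_m)] and 1-Lipschitz functions [G_k] on [N] that tend to [0]
    pointwise while [G_k (f p_m) - G_k (f q_m) >= c * d p_m q_m] for [m >= k].
    Pointwise null bounded sequences are weak*-null, so the images under
    [f^] of the molecules of [(p_m, q_m)] have no weak cluster point in the
    free space, and an ultrafilter limit of these molecules is a functional on
    Lip_0(M) which stays away from [0] on [C_f G_k]; this refutes each of
    (1)-(5).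

    If it holds, then for [g] in the unit ball of Lip_0(N) the values of [g] on
    the finite set [F] determine [C_f g] up to a small Lipschitz norm, so [C_f]
    maps the ball to a totally bounded set.  Schauder's argument transfers this to [f^],
    and completeness gives (1)-(4).  For (5), Helly's theorem approximates a
    functional on Lip_0(M), on a finite net of [C_f] of the ball, by
    combinations of molecules, so that its composition with [C_f] belongs to
    the free space of [N]. *)

(** * Selection principles on the natural numbers *)

(** Recursion on the finite history: [L n] lists the terms chosen so far, and [next] picks one
    related to all of them. The subtype [{x | P x}] carries [P] along. *)
Lemma pairwise_choice (T : Type) (P : T -> Prop) (Q : T -> T -> Prop) :
    (forall s : seq T, (forall x, List.In x s -> P x) ->
       exists t, P t /\ forall x, List.In x s -> Q x t) ->
  exists u : nat -> T, (forall n, P (u n)) /\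
    forall i j, (i < j)%N -> Q (u i) (u j).
Proof.
move=> H.
have H' (s : seq {x | P x}) : exists t : {x | P x},
    forall x, List.In x s -> Q (sval x) (sval t).
  have [|t [Pt Qt]] := H (map sval s).
    by move=> x /List.in_map_iff[[y Py] [/= <- _]].
  exists (exist _ t Pt) => x xs; apply: Qt; exact: List.in_map.
have [next nextP] := choice H'.
pose L := fix L n := if n is m.+1 then next (L m) :: L m else [::].
have LP i j : (i < j)%N -> List.In (next (L i)) (L j).
  elim: j => // j IH; rewrite ltnS leq_eqVlt => /orP[/eqP ->|/IH]; by [left|right].
exists (fun n => sval (next (L n))); split=> [n|i j ij]; first exact: svalP.
exact/nextP/LP.
Qed.

Lemma exists_free_ultrafilter : exists U : set_system nat,
  UltraFilter U /\ forall n, U [set m | (n <= m)%N].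
Proof.
have [U [UU sub]] := ultraFilterLemma eventually_filter.
exists U; split => // n; apply: sub; by exists n.
Qed.

(** A fixed nonprincipal ultrafilter. Limits along it replace the extraction of subsequences: every
    bounded scalar sequence has one. *)
Definition omega : set_system nat := projT1 (cid exists_free_ultrafilter).

#[global] Instance omega_ultra : UltraFilter omega.
Proof. exact: (projT2 (cid exists_free_ultrafilter)).1. Qed.

Lemma omega_ge n : omega [set m | (n <= m)%N].
Proof. exact: (projT2 (cid exists_free_ultrafilter)).2. Qed.

Lemma omega_gt n : omega [set m | (n < m)%N].
Proof. exact: omega_ge. Qed.

Lemma omega_all (T : Type) (s : seq T) (A : T -> set nat) :
  (forall x, List.In x s -> omega (A x)) ->
  omega [set m | forall x, List.In x s -> A x m].
Proof.
elim: s => [|a s IH] H; first by apply: filterE => m x [].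
have Ha := H a (or_introl erefl).
have Hs := IH (fun x xs => H x (or_intror xs)).
by apply: filterS (filterI Ha Hs) => m [am sm] x [<-//|/sm].
Qed.

(** Ramsey's theorem for pairs: one of the two colours is, for [omega]-most [n], the colour of
    [(n, m)] for [omega]-most [m]. Finitely many [omega]-large sets always meet, so inside that set
    of [n] a new term compatible with all earlier ones exists. *)
Lemma ramsey_pairs (c : nat -> nat -> Prop) : exists s : nat -> nat,
  (forall i j, (i < j)%N -> (s i < s j)%N) /\
  ((forall i j, (i < j)%N -> c (s i) (s j)) \/
   (forall i j, (i < j)%N -> ~ c (s i) (s j))).
Proof.
pose J := [set n | omega [set m | c n m]].
have key (I : set nat) (c' : nat -> nat -> Prop) : omega I ->
    (forall n, I n -> omega [set m | c' n m]) ->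
    exists s : nat -> nat, (forall i j, (i < j)%N -> (s i < s j)%N) /\
      forall i j, (i < j)%N -> c' (s i) (s j).
  move=> oI Ic.
  have [|s [_ sP]] := @pairwise_choice nat I (fun n m => (n < m)%N /\ c' n m).
    move=> s sI.
    have h' : omega [set m | forall x, List.In x s -> (x < m)%N /\ c' x m].
      apply: (@omega_all nat s (fun x => [set m | (x < m)%N /\ c' x m])) => x xs.
      by apply: filterI; [exact: omega_gt|exact/Ic/sI].
    have [m [Im hm]] := filter_ex (filterI oI h').
    by exists m.
  by exists s; split=> i j /sP[].
have [oJ|oJ] := in_ultra_setVsetC J omega_ultra.
  have [s [si sc]] := key J c oJ (fun n => id).
  by exists s; split => //; left.
have [|s [si sc]] := key _ (fun n m => ~ c n m) oJ.
  move=> n Jn.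
  by have [//|] := in_ultra_setVsetC [set m | c n m] omega_ultra.
by exists s; split => //; right.
Qed.

(** * Real sequences and tail suprema of Lipschitz functions *)

Section RealFunctions.
Variable R : realType.

Lemma exists_natSV_lt (e : R) : 0 < e -> exists n : nat, n.+1%:R^-1 < e.
Proof.
move=> e0; exists (Num.truncn e^-1).
rewrite invf_plt ?posrE ?ltr0Sn //; exact: truncnS_gt.
Qed.

Lemma halving_small (r : nat -> R) : (forall n, 0 <= r n) ->
    (forall n, r n.+1 <= r n / 2) ->
  forall e : R, 0 < e -> exists n0, forall n, (n0 <= n)%N -> r n <= e.
Proof.
move=> r0 rh e e0.
(* A linear rate in place of [2 ^ n]: the induction closes because [n + 2 <= 2 * (n + 1)]. *)
have H n : n.+1%:R * r n <= r 0%N.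
  elim: n => [|n IH]; first by rewrite mul1r.
  apply: le_trans IH.
  have rn := r0 n; have h := rh n; have n0 : 0 <= n%:R :> R by [].
  have -> : n.+2%:R = n%:R + 2 :> R by rewrite -addn2 natrD.
  have -> : n.+1%:R = n%:R + 1 :> R by rewrite -addn1 natrD.
  have : (n%:R + 2) * r n.+1 <= (n%:R + 2) * (r n / 2) by apply: ler_wpM2l; lra.
  nra.
have e1 : 0 < e / (r 0%N + 1) by rewrite divr_gt0 // ltr_wpDl.
have [n0 hn0] := exists_natSV_lt e1.
exists n0 => n le_n.
have r1 : 0 < r 0%N + 1 by rewrite ltr_wpDl.
move: hn0; rewrite ltr_pdivlMr // -ltr_pdivlMl ?invr_gt0 ?ltr0Sn // invrK => h.
have : r n * n0.+1%:R <= e * n0.+1%:R.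
  apply: le_trans (_ : n.+1%:R * r n <= _).
    by rewrite mulrC ler_wpM2r // ler_nat.
  apply: (le_trans (H n)); rewrite mulrC; lra.
by rewrite ler_pM2r ?ltr0Sn.
Qed.

(** [G k] is the supremum of the [h n] with [n >= k]. Suprema preserve the Lipschitz constant 1,
    tails inherit the pointwise convergence to 0, and one [G k] dominates all later [h n] at
    once. *)
Lemma sup_lipschitz_family (N : Type) (d : N -> N -> R) (h : nat -> N -> R) :
    (forall n z z', h n z <= h n z' + d z z') ->
    (forall n z, 0 <= h n z) ->
    (forall z, exists B, forall n, h n z <= B) ->
    (forall z (e : R), 0 < e -> exists k0, forall n, (k0 <= n)%N -> h n z <= e) ->
  exists G : nat -> N -> R,
    [/\ forall k z z', G k z <= G k z' + d z z',
        forall z (e : R), 0 < e -> exists k0, forall k, (k0 <= k)%N -> `|G k z| <= e,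
        forall k n z, (k <= n)%N -> h n z <= G k z
      & forall k z B, (forall n, (k <= n)%N -> h n z <= B) -> G k z <= B].
Proof.
move=> hl h0 hb hc.
pose E k z : set R := [set r | exists n, (k <= n)%N /\ r = h n z].
pose G k z := sup (E k z).
have G_ge k n z : (k <= n)%N -> h n z <= G k z.
  move=> kn; apply: ub_le_sup; last by exists n.
  by have [B hB] := hb z; exists B => _ [m [_ ->]].
have G_le k z B : (forall n, (k <= n)%N -> h n z <= B) -> G k z <= B.
  move=> H; apply: ge_sup; first by exists (h k z), k.
  by move=> _ [m [km ->]]; exact: H.
exists G; split => //.
  move=> k z z'; apply: G_le => n kn.
  by apply: le_trans (hl n z z') _; rewrite lerD2r G_ge.
move=> z e e0; have [k0 hk] := hc z e e0.
exists k0 => k kk; rewrite ger0_norm; last exact: le_trans (h0 k z) (G_ge _ _ _ _).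
by apply: G_le => n kn; apply: hk; exact: leq_trans kn.
Qed.
End RealFunctions.

(** * Escaping Lipschitz functions *)

Section EscapingFunctions.
Variable R : realType.

(** A single [G k] separates all pairs of index at least [k]; thus a limit over [m] of the molecules
    stays bounded below on each [G k]. *)
Definition escaping (N : Type) (d : N -> N -> R) (p q : nat -> N) (r : nat -> R)
    (G : nat -> N -> R) : Prop :=
  [/\ forall k z z', G k z <= G k z' + d z z',
      forall z (e : R), 0 < e -> exists k0, forall k, (k0 <= k)%N -> `|G k z| <= e
    & forall k m, (k <= m)%N -> r m <= G k (p m) - G k (q m)].

(** Cones of height [r n / 16] about the points [u n] have disjoint supports and vanish at every
    [v m]; [G k] is the supremum of those of index at least [k]. *)
Lemma escaping_bumps (N : Type) (d : N -> N -> R) (u v : nat -> N) (r : nat -> R) :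
    is_metric d -> (forall n, 0 < r n) -> (forall n, r n < d (u n) (v n)) ->
    (forall i j, (i < j)%N -> r j < d (u j) (u i) /\ r j < d (u j) (v i)) ->
    (forall i j, (i < j)%N -> r i / 8 <= d (u j) (u i) /\ r i / 8 <= d (v j) (u i)) ->
  exists G, escaping d u v (fun n => r n / 16) G.
Proof.
move=> [d0 dE dC dT] r0 ruv far near.
pose h n z := Num.max 0 (r n / 16 - d z (u n)).
have hge0 n z : 0 <= h n z by rewrite le_max lexx.
have hpos n z : 0 < h n z -> d z (u n) < r n / 16.
  by rewrite lt_max ltxx /= subr_gt0.
have h_le n z : h n z <= r n / 16.
  by rewrite ge_max; apply/andP; split; [have := r0 n; lra | have := d0 z (u n); lra].
have disj n m z : (n < m)%N -> 0 < h n z -> 0 < h m z -> False.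
  move=> nm /hpos hn /hpos hm; have [f1 _] := far _ _ nm; have [f2 _] := near _ _ nm.
  have := dT (u m) z (u n); rewrite (dC (u m) z); have := r0 m; lra.
have only n m z : n != m -> 0 < h n z -> h m z = 0.
  move=> nm hn; apply/eqP; rewrite eq_le hge0 andbT leNgt; apply/negP => hm.
  case: (ltngtP n m) nm => // lt _; [exact: (disj _ _ _ lt hn hm)|exact: (disj _ _ _ lt hm hn)].
(* Later points [v m] are excluded by [near], earlier ones by [far], and the partner of [u n] by
   [ruv]. *)
have hv n m : h n (v m) <= 0.
  rewrite ge_max lexx subr_le0 /=; have rn := r0 n.
  case: (ltngtP n m) => [nm|mn|->].
  - have [_] := near _ _ nm; lra.
  - have [_] := far _ _ mn; rewrite dC; lra.
  - have := ruv m; have := r0 m; rewrite dC; lra.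
have [|//|||G [Gl Gc Gge Gle]] := @sup_lipschitz_family R N d h.
- move=> n z z'; rewrite {1}/h ge_max; apply/andP; split.
    by rewrite addr_ge0.
  have := dT z' z (u n); rewrite (dC z' z) => H.
  have : r n / 16 - d z' (u n) <= h n z' by rewrite le_max lexx orbT.
  lra.
- move=> z; have [[n hn]|no] := pselect (exists n, 0 < h n z).
    exists (h n z) => m; have [->//|nm] := eqVneq n m.
    by rewrite (only _ _ _ nm hn).
  exists 0 => m; rewrite leNgt; apply/negP => hm; apply: no; by exists m.
- move=> z e e0; have [[n hn]|no] := pselect (exists n, 0 < h n z).
    exists n.+1 => m nm; rewrite (only n) ?ltW // ; by rewrite neq_ltn nm.
  exists 0%N => m _; apply: le_trans (ltW e0).
  rewrite leNgt; apply/negP => hm; apply: no; by exists m.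
exists G; split => // k m km.
have H1 := Gge _ _ (u m) km; have H2 := Gle k (v m) 0 (fun n _ => hv n m).
have : r m / 16 <= h m (u m).
  by rewrite le_max; apply/orP; right; rewrite (dE (u m) (u m)).2 // subr0.
lra.
Qed.

(** The pairs cluster at [p] on rapidly decreasing scales: [u n] is within [r n / 7] of [p], hence
    [v n] is at least [6 / 7 * r n] away. The truncated radial function [h n] vanishes at [u n] and
    reaches its cap [r n / 4] at [v n], which explains the order [v], [u] in the conclusion. *)
Lemma escaping_radial (N : Type) (d : N -> N -> R) (u v : nat -> N) (r : nat -> R)
    (p : N) :
    is_metric d -> (forall n, 0 < r n) -> (forall n, r n < d (u n) (v n)) ->
    (forall i j, (i < j)%N -> r j <= r i / 7) ->
    (forall n, d (u n) p <= r n / 7) ->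
  exists G, escaping d v u (fun n => r n / 16) G.
Proof.
move=> [d0 dE dC dT] r0 ruv dec near.
pose h n z := Num.min (Num.max 0 (d z p - r n / 4)) (r n / 4).
have hge0 n z : 0 <= h n z by rewrite le_min le_max lexx /=; have := r0 n; lra.
have h_le n z : h n z <= r n / 4 by rewrite ge_min lexx orbT.
have r_small e : 0 < e -> exists n0, forall n, (n0 <= n)%N -> r n <= e.
  apply: halving_small => n; first exact: ltW.
  have := dec n n.+1 (ltnSn n); have := r0 n; lra.
have r_le n : r n <= r 0%N.
  case: n => // n; have := dec 0%N n.+1 isT; have := r0 0%N; lra.
have [|//|||G [Gl Gc Gge Gle]] := @sup_lipschitz_family R N d h.
- move=> n z z'; rewrite /h; have ? := dT z z' p; have ? := d0 z z'; have ? := r0 n.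
  rewrite -lerBlDr le_min; apply/andP; split; rewrite lerBlDr ge_min.
    apply/orP; left; rewrite ge_max -!lerBlDr !le_max.
    by apply/andP; split; apply/orP; [left|right]; lra.
  by apply/orP; right; lra.
- move=> z; exists (r 0%N / 4) => n.
  by apply: le_trans (h_le n z) _; have := r_le n; lra.
- move=> z e e0; have [n0 hn0] := r_small e e0; exists n0 => n /hn0 rn.
  by apply: le_trans (h_le n z) _; have := r0 n; lra.
exists G; split => // k m km; have rm := r0 m.
have H1 := Gge _ _ (v m) km.
(* For [n > m] the cap gives [r n / 4 <= r m / 28]; for [n <= m] the function [h n] vanishes at
   [u m], since [r m / 7 < r n / 4]. *)
have H2 : G k (u m) <= r m / 28.
  apply: Gle => n _; have [mn|nm] := ltnP m n.
    by apply: le_trans (h_le _ _) _; have := dec _ _ mn; lra.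
  have rmn : r m <= r n.
    move: nm; rewrite leq_eqVlt => /orP[/eqP ->//|/dec]; have := r0 n; lra.
  rewrite ge_min; apply/orP; left; rewrite ge_max; apply/andP; split; first lra.
  have := near m; lra.
have : r m / 4 <= h m (v m).
  rewrite le_min lexx andbT le_max; apply/orP; right.
  have := near m; have := ruv m; have := dT (u m) p (v m); rewrite (dC p (v m)); lra.
lra.
Qed.

(** The radii decay geometrically, so [u] is Cauchy, and the estimate passes to the limit.
    Completeness of the target space enters here. *)
Lemma nested_cauchy_limit (N : Type) (d : N -> N -> R) (u : nat -> N) (r : nat -> R) :
    is_metric d -> complete_metric d -> (forall n, 0 < r n) ->
    (forall i j, (i < j)%N -> r j <= r i / 7) ->
    (forall i j, (i < j)%N -> d (u j) (u i) <= r i / 7) ->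
  exists p, forall n, d (u n) p <= r n / 7.
Proof.
move=> [d0 dE dC dT] cN r0 dec near.
have near' n0 n : (n0 <= n)%N -> d (u n) (u n0) <= r n0 / 7.
  rewrite leq_eqVlt => /orP[/eqP ->|/near//]; rewrite (dE _ _).2 //; have := r0 n; lra.
have [|p hp] := cN u.
  move=> e e0.
  have [||n0 hn0] := @halving_small R r _ _ e e0.
  - by move=> n; exact: ltW.
  - by move=> n; have := dec n n.+1 (ltnSn n); have := r0 n; lra.
  exists n0 => m n /near' hm /near' hn; have := hn0 n0 (leqnn n0).
  have := dT (u m) (u n0) (u n); rewrite (dC (u n0) (u n)); have := r0 n0; lra.
exists p => n; rewrite leNgt; apply/negP => lt.
have [|n0 hn0] := hp (d (u n) p - r n / 7); first by rewrite subr_gt0.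
have := hn0 (maxn n0 n) (leq_maxl _ _); have := near' n (maxn n0 n) (leq_maxr _ _).
have := dT (u n) (u (maxn n0 n)) p; rewrite (dC (u n) (u (maxn n0 n))); lra.
Qed.

Definition finitely_flat (M N : Type) (dM : M -> M -> R) (dN : N -> N -> R)
    (f : M -> N) : Prop :=
  forall e : R, 0 < e -> exists F : seq N, forall x y,
    dN (f x) (f y) <= e * dM x y \/
    (exists z, List.In z F /\ dN (f x) z <= e * dM x y) /\
    (exists z, List.In z F /\ dN (f y) z <= e * dM x y).

(** Pairs are chosen greedily against the images of all earlier ones. Two Ramsey selections then
    decide whether the later images of first, or of second, points approach [f (x i)] on the scale
    [rho i]: if so, radial functions at a limit point work, and otherwise disjoint bumps do. *)
Lemma escaping_of_not_flat (M N : Type) (dM : M -> M -> R) (dN : N -> N -> R)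
    (f : M -> N) :
    is_metric dM -> is_metric dN -> complete_metric dN ->
    ~ finitely_flat dM dN f ->
  exists (p q : nat -> M) (c : R) (G : nat -> N -> R),
    [/\ 0 < c, forall n, 0 < dM (p n) (q n) &
        escaping dN (f \o p) (f \o q) (fun n => c * dM (p n) (q n)) G].
Proof.
move=> hM hN cN nflat; have [m0 mE mC mT] := hM; have [d0 dE dC dT] := hN.
(* The condition is symmetric in the pair, so after a swap the point with image far from [F] is the
   first one. *)
have [e [e0 He]] : exists e, 0 < e /\ forall F : seq N, exists x y,
    e * dM x y < dN (f x) (f y) /\
    forall z, List.In z F -> e * dM x y < dN (f x) z.
  apply: contrapT => no; apply: nflat => e e0; apply: contrapT => noF.
  apply: no; exists e; split => // F; apply: contrapT => noxy.
  apply: noF; exists F => x y.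
  have [le|lt] := leP (dN (f x) (f y)) (e * dM x y); [by left|right].
  split; apply: contrapT => noz; apply: noxy.
    exists x, y; split => // z zF; rewrite ltNge; apply/negP => le.
    by apply: noz; exists z.
  exists y, x; rewrite mC dC; split => // z zF; rewrite ltNge; apply/negP => le.
  by apply: noz; exists z.
have [|s [s1 s2]] := @pairwise_choice (M * M)
    (fun t => e * dM t.1 t.2 < dN (f t.1) (f t.2))
    (fun s t => e * dM t.1 t.2 < dN (f t.1) (f s.1) /\
                e * dM t.1 t.2 < dN (f t.1) (f s.2)).
  move=> s _.
  have [x [y [h1 h2]]] := He (map (fun t => f t.1) s ++ map (fun t => f t.2) s).
  exists (x, y); split => // t ts; split; apply: h2; apply: List.in_or_app.
    by left; exact: (List.in_map (fun t => f t.1)).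
  by right; exact: (List.in_map (fun t => f t.2)).
pose r n := e * dM (s n).1 (s n).2.
have [t1 [t1i t1c]] := ramsey_pairs
  (fun i j => dN (f (s j).1) (f (s i).1) < r i / 8).
have [t2 [t2i t2c]] := ramsey_pairs
  (fun i j => dN (f (s (t1 j)).2) (f (s (t1 i)).1) < r (t1 i) / 8).
pose t n := t1 (t2 n).
have ti i j : (i < j)%N -> (t i < t j)%N by move=> /t2i/t1i.
pose x n := (s (t n)).1; pose y n := (s (t n)).2; pose rho n := r (t n).
have dpos n : 0 < dM (x n) (y n).
  rewrite lt_neqAle m0 andbT eq_sym; apply/eqP => /mE exy.
  have := s1 (t n); rewrite -/(x n) -/(y n) exy (dE _ _).2 // (mE _ _).2 //.
  by rewrite mulr0 ltxx.
have rho0 n : 0 < rho n by rewrite mulr_gt0 // dpos.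
have H1 n : rho n < dN (f (x n)) (f (y n)) by exact: s1.
have H2 i j : (i < j)%N -> rho j < dN (f (x j)) (f (x i)) /\
    rho j < dN (f (x j)) (f (y i)) by move=> /ti/s2.
have radial : (forall i j, (i < j)%N -> rho j <= rho i / 7 /\
      dN (f (x j)) (f (x i)) <= rho i / 7) ->
    exists (p q : nat -> M) (c : R) (G : nat -> N -> R),
    [/\ 0 < c, forall n, 0 < dM (p n) (q n) &
        escaping dN (f \o p) (f \o q) (fun n => c * dM (p n) (q n)) G].
  move=> H.
  have [||p pP] := @nested_cauchy_limit N dN (f \o x) rho hN cN rho0.
  - by move=> i j /H[].
  - by move=> i j /H[].
  have [|//|G GP] := @escaping_radial N dN (f \o x) (f \o y) rho p hN rho0 H1.
    by move=> i j /H[].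
  exists y, x, (e / 16), G; split; first lra.
    by move=> n; rewrite mC.
  case: GP => a b GP; split => // k m km; apply: le_trans (GP k m km).
  by rewrite mC /rho /r -/(x m) -/(y m); lra.
case: t1c => t1c.
  apply: radial => i j ij; have := t1c _ _ (t2i _ _ ij); have [] := H2 _ _ ij.
  rewrite -/(t i) -/(t j) -/(x i) -/(x j) -/(rho i); have := rho0 i.
  by move=> ? ? ? ?; split; lra.
(* If second points approach, [f (y j.+1)] is near both [f (x i)] and [f (x j)]. Then [rho j < dN (f
   (x j)) (f (x i)) < rho j / 8 + rho i / 8], whence [rho j < rho i / 7], and the distance is below
   [rho i / 56 + rho i / 8 = rho i / 7]. This is the source of the constant 7. *)
case: t2c => t2c.
  apply: radial => i j ij; have [a _] := H2 _ _ ij.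
  have := t2c _ _ (ltnSn j); have := t2c _ _ (ltn_trans ij (ltnSn j)).
  rewrite -/(t i) -/(t j) -/(t j.+1) -/(x i) -/(x j) -/(y j.+1) -/(rho i) -/(rho j).
  have := dT (f (x j)) (f (y j.+1)) (f (x i)); rewrite (dC (f (x j)) (f (y j.+1))).
  by move=> ? ? ?; have := rho0 i; have := rho0 j => *; split; lra.
have [|G GP] := @escaping_bumps N dN (f \o x) (f \o y) rho hN rho0 H1 H2.
  move=> i j ij; split; rewrite leNgt; apply/negP; last exact: t2c.
  by apply: t1c; exact: t2i.
exists x, y, (e / 16), G; split => //; first lra.
case: GP => a b GP; split => // k m km; apply: le_trans (GP k m km).
by rewrite /rho /r -/(x m) -/(y m); lra.
Qed.
End EscapingFunctions.

(** * Scalars and ultralimits *)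

(* [re], [im] and [ii] cover both scalar fields at once: over the reals
   [im] and [ii] vanish identically. *)
Record scalar_structure (R : realType) (K : numFieldType) (emb : R -> K) :=
  ScalarStructure {
    nrm : K -> R;
    re : K -> R;
    im : K -> R;
    ii : K;
    normE : forall z, `|z| = emb (nrm z);
    emb_le : forall a b, (emb a <= emb b) = (a <= b);
    embD : {morph emb : a b / a + b};
    embM : {morph emb : a b / a * b};
    emb1 : emb 1 = 1;
    reD : {morph re : a b / a + b};
    imD : {morph im : a b / a + b};
    re1 : re 1 = 1;
    reZ : forall a z, re (emb a * z) = a * re z;
    imZ : forall a z, im (emb a * z) = a * im z;
    re_ii : forall z, re (ii * z) = - im z;
    re_le : forall z, `|re z| <= nrm z;
    im_le : forall z, `|im z| <= nrm z;
    scalarE : forall z, z = emb (re z) + ii * emb (im z);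
    nrm_ii : nrm ii <= 1 }.

Section Scalars.
Variables (R : realType) (K : numFieldType) (emb : R -> K).
Variable sc : scalar_structure emb.
Local Notation nrm := (nrm sc).
Local Notation re := (re sc).
Local Notation im := (im sc).
Local Notation ii := (ii sc).

Lemma emb_inj : injective emb.
Proof.
by move=> a b ab; apply/eqP; rewrite eq_le -!(emb_le sc) ab lexx.
Qed.

Lemma emb0 : emb 0 = 0.
Proof. by apply: (addrI (emb 0)); rewrite -(embD sc) !addr0. Qed.

Lemma embN a : emb (- a) = - emb a.
Proof. by apply: (addrI (emb a)); rewrite -(embD sc) !subrr emb0. Qed.

Lemma embB a b : emb (a - b) = emb a - emb b.
Proof. by rewrite (embD sc) embN. Qed.

Lemma emb_lt a b : (emb a < emb b) = (a < b).
Proof. by rewrite !lt_def (emb_le sc) (inj_eq emb_inj). Qed.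

Lemma norm_le_emb z c : (`|z| <= emb c) = (nrm z <= c).
Proof. by rewrite (normE sc) (emb_le sc). Qed.

Lemma norm_lt_emb z c : (`|z| < emb c) = (nrm z < c).
Proof. by rewrite (normE sc) emb_lt. Qed.

Lemma nrm_ge0 z : 0 <= nrm z.
Proof. by rewrite -(emb_le sc) emb0 -(normE sc). Qed.

Lemma nrmD a b : nrm (a + b) <= nrm a + nrm b.
Proof. by rewrite -(emb_le sc) (embD sc) -!(normE sc) ler_normD. Qed.

Lemma nrmM a b : nrm (a * b) = nrm a * nrm b.
Proof. by apply: emb_inj; rewrite (embM sc) -!(normE sc) normrM. Qed.

Lemma nrmN a : nrm (- a) = nrm a.
Proof. by apply: emb_inj; rewrite -!(normE sc) normrN. Qed.

Lemma nrmB a b : nrm (a - b) <= nrm a + nrm b.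
Proof. by rewrite -(nrmN b) nrmD. Qed.

Lemma nrmBC a b : nrm (a - b) = nrm (b - a).
Proof. by rewrite -nrmN opprB. Qed.

Lemma nrm0 : nrm 0 = 0.
Proof. by apply: emb_inj; rewrite -(normE sc) normr0 emb0. Qed.

Lemma nrm1 : nrm 1 = 1.
Proof. by apply: emb_inj; rewrite -(normE sc) normr1 (emb1 sc). Qed.

Lemma nrm_tri b a c : nrm (a - c) <= nrm (a - b) + nrm (b - c).
Proof. by rewrite -[a - c](subrKA b) nrmD. Qed.

Lemma nrm_emb a : nrm (emb a) = `|a|.
Proof.
apply: emb_inj; rewrite -(normE sc).
have [a0|a0] := leP 0 a; first by rewrite (ger0_norm a0) ger0_norm // -emb0 (emb_le sc).
by rewrite (ltr0_norm a0) ler0_norm ?embN // -emb0 (emb_le sc) ltW.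
Qed.

Lemma nrm_eq0 a : nrm a = 0 -> a = 0.
Proof. by move=> h; apply/eqP; rewrite -normr_eq0 (normE sc) h emb0. Qed.

Lemma nrm_le_re_im z : nrm z <= `|re z| + `|im z|.
Proof.
rewrite {1}(scalarE sc z); apply: le_trans (nrmD _ _) _.
rewrite nrmM !nrm_emb lerD2l ler_piMl //; exact: nrm_ii.
Qed.

Lemma re0 : re 0 = 0.
Proof. by apply: (addrI (re 0)); rewrite -(reD sc) !addr0. Qed.

Lemma im0 : im 0 = 0.
Proof. by apply: (addrI (im 0)); rewrite -(imD sc) !addr0. Qed.

Lemma reN a : re (- a) = - re a.
Proof. by apply: (addrI (re a)); rewrite -(reD sc) !subrr re0. Qed.

Lemma imN a : im (- a) = - im a.
Proof. by apply: (addrI (im a)); rewrite -(imD sc) !subrr im0. Qed.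

Lemma reB a b : re (a - b) = re a - re b.
Proof. by rewrite (reD sc) reN. Qed.

Lemma imB a b : im (a - b) = im a - im b.
Proof. by rewrite (imD sc) imN. Qed.

Lemma re_emb a : re (emb a) = a.
Proof. by rewrite -[emb a]mulr1 (reZ sc) (re1 sc) mulr1. Qed.

Definition ulim (s : nat -> K) (l : K) : Prop :=
  forall e : R, 0 < e -> omega [set m | nrm (s m - l) < e].

Lemma real_ulim_ex (s : nat -> R) (B : R) : omega [set m | `|s m| <= B] ->
  exists l, forall e : R, 0 < e -> omega [set m | `|s m - l| < e].
Proof.
(* The limit is the supremum of the levels that [s] reaches for [omega]-most [m]. *)
move=> sB; pose E : set R := [set t | omega [set m | t <= s m]].
have Eub : ubound E B.
  move=> t Et; have [m [/= tm]] := filter_ex (filterI Et sB).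
  by rewrite ler_norml => /andP[_]; exact: le_trans.
have E0 : E !=set0.
  by exists (- B); apply: filterS sB => m /=; rewrite ler_norml => /andP[].
exists (sup E) => e e0.
have [t Et lt] := sup_adherent e0 (conj E0 (ex_intro _ B Eub)).
have [Ee|nEe] := in_ultra_setVsetC [set m | sup E + e <= s m] omega_ultra.
  have := @ub_le_sup _ E (ex_intro _ B Eub) _ Ee; lra.
apply: filterS (filterI Et nEe) => m [/= tm /negP].
rewrite -ltNge => h; rewrite ltr_norml; apply/andP; split; lra.
Qed.

Lemma ulim_ex (s : nat -> K) (B : R) : omega [set m | nrm (s m) <= B] ->
  exists l, ulim s l.
Proof.
move=> sB.
have [|a Ha] := @real_ulim_ex (re \o s) B.
  by apply: filterS sB => m /= ; exact/le_trans/re_le.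
have [|b Hb] := @real_ulim_ex (im \o s) B.
  by apply: filterS sB => m /= ; exact/le_trans/im_le.
exists (emb a + ii * emb b) => e e0.
have e2 : 0 < e / 2 by lra.
apply: filterS (filterI (Ha _ e2) (Hb _ e2)) => m [/= h1 h2].
rewrite [s m](scalarE sc) opprD addrACA -mulrBr -!embB.
apply: le_lt_trans (nrmD _ _) _; rewrite nrmM !nrm_emb.
have : nrm ii * `|im (s m) - b| <= `|im (s m) - b| by rewrite ler_piMl // nrm_ii.
lra.
Qed.

Lemma ulim_le (s : nat -> K) (l a : K) (B : R) : ulim s l ->
  omega [set m | nrm (s m - a) <= B] -> nrm (l - a) <= B.
Proof.
move=> sl sB; rewrite leNgt; apply/negP => lt.
have e0 : 0 < nrm (l - a) - B by lra.
have [m [/= h1 h2]] := filter_ex (filterI (sl _ e0) sB).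
have := nrm_tri (s m) l a; rewrite (nrmBC l (s m)); lra.
Qed.

Lemma ulim_unique (s : nat -> K) (l l' : K) : ulim s l -> ulim s l' -> l = l'.
Proof.
move=> sl sl'; apply/eqP; rewrite -subr_eq0; apply/eqP/nrm_eq0/eqP.
rewrite eq_le nrm_ge0 andbT; apply/ler_addgt0Pl => e e0; rewrite addr0.
by apply: ulim_le sl _; apply: filterS (sl' _ e0) => m /= /ltW.
Qed.

Lemma ulim_linear (s t : nat -> K) (a l k : K) : ulim s l -> ulim t k ->
  ulim (fun m => a * s m + t m) (a * l + k).
Proof.
move=> sl tk e e0; have a0 := nrm_ge0 a.
have e1 : 0 < e / 2 / (nrm a + 1) by rewrite divr_gt0 ?ltr_wpDl //; lra.
have e2 : 0 < e / 2 by lra.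
apply: filterS (filterI (sl _ e1) (tk _ e2)) => m [/= h1 h2].
rewrite opprD addrACA -mulrBr; apply: le_lt_trans (nrmD _ _) _; rewrite nrmM.
move: h1; rewrite ltr_pdivlMr ?ltr_wpDl // => h1.
have := nrm_ge0 (s m - l); nra.
Qed.

Lemma ulim_cst a : ulim (fun=> a) a.
Proof. by move=> e e0; apply: filterE => m /=; rewrite subrr nrm0. Qed.

Lemma ulim_re_ge (s : nat -> K) (l : K) (c : R) : ulim s l ->
  omega [set m | c <= re (s m)] -> c <= re l.
Proof.
move=> sl sc'; rewrite leNgt; apply/negP => lt.
have e0 : 0 < c - re l by lra.
have [m [/= h1 h2]] := filter_ex (filterI (sl _ e0) sc').
have := re_le sc (s m - l); rewrite reB ler_norml => /andP[_]; lra.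
Qed.

(** The default value 0 is taken only when no limit exists, which boundedness rules out. *)
Definition ulimit (s : nat -> K) : K := xget 0 [set l | ulim s l].

Lemma ulimitP (s : nat -> K) (B : R) : omega [set m | nrm (s m) <= B] ->
  ulim s (ulimit s).
Proof. by move=> /ulim_ex; exact: xgetPex. Qed.

(** Without a net, [pairwise_choice] gives a sequence in [B] any two terms of which differ by more
    than [e] in some coordinate. The finitely many bounded coordinates converge along [omega], so
    two terms agree within [e] in all of them. *)
Lemma finite_net (T I : Type) (l : seq I) (phi : I -> T -> K) (C : I -> R)
    (B : T -> Prop) :
    (forall i x, List.In i l -> B x -> nrm (phi i x) <= C i) ->
  forall e : R, 0 < e -> exists s : seq T, (forall x, List.In x s -> B x) /\
    forall x, B x -> exists y, List.In y s /\
      forall i, List.In i l -> nrm (phi i x - phi i y) <= e.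
Proof.
move=> phiC e e0; apply: contrapT => no.
have [|u [uB uP]] := @pairwise_choice T B
    (fun x y => ~ forall i, List.In i l -> nrm (phi i y - phi i x) <= e).
  move=> s sB; apply: contrapT => not; apply: no; exists s; split => // x Bx.
  apply: contrapT => noy; apply: not; exists x; split => // y ys H.
  by apply: noy; exists y.
pose a i := ulimit (fun n => phi i (u n)).
have e2 : 0 < e / 2 by lra.
have H : omega [set m | forall i, List.In i l -> nrm (phi i (u m) - a i) < e / 2].
  apply: (@omega_all _ l (fun i => [set m | nrm (phi i (u m) - a i) < e / 2])) => i il.
  apply: (@ulimitP _ (C i)) e2.
  by apply: filterE => m /=; exact: phiC.
have [n /= Hn] := filter_ex H.
have [m [/= nm Hm]] := filter_ex (filterI (omega_gt n) H).
apply: (uP n m nm) => i il; have := Hn i il; have := Hm i il.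
have := nrm_tri (a i) (phi i (u m)) (phi i (u n)); rewrite (nrmBC (a i) (phi i (u n))); lra.
Qed.

End Scalars.

Lemma real_scalar_structure (R : realType) : scalar_structure (K := R) (@id R).
Proof.
apply: (@ScalarStructure R R id (fun z => `|z|) id (fun=> 0) 0) => //=.
- by move=> a b; rewrite addr0.
- by move=> a z; rewrite mulr0.
- by move=> z; rewrite mul0r oppr0.
- by move=> z; rewrite normr0.
- by move=> z; rewrite mul0r addr0.
- by rewrite normr0.
Qed.

Lemma complex_scalar_structure (R : realType) :
  scalar_structure (K := R[i]) (fun r : R => (r%:C)%C).
Proof.
apply: (@ScalarStructure R R[i] (fun r : R => (r%:C)%C)
  (@Normc.normc R) (@complex.Re R) (@complex.Im R) ('i)%C) => //=.
- by move=> a b; rewrite lecR.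
- by move=> a b; rewrite rmorphD.
- by move=> a b; rewrite rmorphM.
- by move=> [a b] [c d].
- by move=> [a b] [c d].
- by move=> a [b c] /=; rewrite mul0r subr0.
- by move=> a [b c] /=; rewrite mul0r addr0.
- by move=> [a b] /=; rewrite mul0r mul1r sub0r.
- by move=> [a b] /=; rewrite -sqrtr_sqr ler_sqrt ?lerDl ?sqr_ge0 ?addr_ge0 ?sqr_ge0.
- by move=> [a b] /=; rewrite -sqrtr_sqr ler_sqrt ?lerDr ?sqr_ge0 ?addr_ge0 ?sqr_ge0.
- by move=> z; exact: complexE.
- by rewrite expr0n expr1n add0r sqrtr1.
Qed.

(** * Weak and norm topologies *)

Section Topology.
Variables (R : realType) (K : numFieldType) (emb : R -> K).
Variable sc : scalar_structure emb.
Local Notation nrm := (nrm sc).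
Variables (X : Type) (S : (X -> K) -> Prop) (nb : (X -> K) -> R -> Prop).

Lemma weak_open_norm_open (U : (X -> K) -> Prop) :
  (forall v w, S v -> S w -> S (fun t => w t - v t)) ->
  weak_open emb S nb U -> norm_open S nb U.
Proof.
move=> SB wU v Sv Uv; have [n [L [e [e0 [Lc LU]]]]] := wU v Sv Uv.
have [C HC] := choice (fun i => (Lc i).2).
(* The summand 1 puts [D] strictly above every [|C i|] and keeps it positive when there are no
   functionals. *)
pose D := 1 + \sum_i `|C i|.
have D0 : 0 < D by rewrite ltr_pwDl // sumr_ge0.
have CD i : `|C i| < D.
  rewrite /D (bigD1 i) //= addrCA ltrDl ltr_pwDl // sumr_ge0 //.
exists (e / D); split; first exact: divr_gt0.
move=> w Sw nbw; apply: LU => // i.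
have -> : L i w - L i v = L i (fun t => w t - v t).
  have -> : (fun t => w t - v t) = (fun t => -1 * v t + w t).
    by apply: funext => t; rewrite mulN1r addrC.
  by rewrite (Lc i).1 // mulN1r addrC.
have := HC i _ _ (SB _ _ Sv Sw) nbw; rewrite !(norm_le_emb sc) (norm_lt_emb sc).
move=> h; apply: (le_lt_trans h).
apply: le_lt_trans (_ : `|C i| * (e / D) < _).
  by rewrite ler_wpM2r ?ler_norm // ltW // divr_gt0.
by rewrite mulrCA gtr_pMr // ltr_pdivrMr // mul1r.
Qed.

Lemma weak_openI (U V : (X -> K) -> Prop) :
  weak_open emb S nb U -> weak_open emb S nb V ->
  weak_open emb S nb (fun w => U w /\ V w).
Proof.
move=> wU wV v Sv [Uv Vv].
have [n [L [e [e0 [Lc LU]]]]] := wU v Sv Uv.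
have [n' [L' [e' [e'0 [Lc' LV]]]]] := wV v Sv Vv.
exists (n + n')%N, (fun i => match split i with inl j => L j | inr j => L' j end),
  (Num.min e e'); split; first by rewrite lt_min e0.
split=> [i|w Sw H]; first by case: (split i).
split; [apply: LU => // i|apply: LV => // i].
- have := H (lshift n' i); rewrite (unsplitK (inl i)) !(norm_lt_emb sc).
  by rewrite lt_min => /andP[].
- have := H (rshift n i); rewrite (unsplitK (inr i)) !(norm_lt_emb sc).
  by rewrite lt_min => /andP[].
Qed.

Lemma norm_openI (U V : (X -> K) -> Prop) :
  (forall v a b, nb v a -> a <= b -> nb v b) ->
  norm_open S nb U -> norm_open S nb V -> norm_open S nb (fun w => U w /\ V w).
Proof.
move=> mono oU oV v Sv [Uv Vv].
have [e [e0 eU]] := oU v Sv Uv; have [e' [e'0 eV]] := oV v Sv Vv.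
exists (Num.min e e'); rewrite lt_min e0; split => // w Sw nw.
by split; [apply: eU => //|apply: eV => //];
  apply: mono nw _; rewrite ge_min lexx ?orbT.
Qed.

(** The abstract open condition [P] treats open balls and exteriors of closed balls together. *)
Lemma weak_open_ball (L : (X -> K) -> K) (a : K) (P : R -> Prop) :
    cont_lin_functional emb S nb L ->
    (forall r, P r -> exists e, 0 < e /\ forall r', `|r' - r| < e -> P r') ->
  weak_open emb S nb (fun w => P (nrm (L w - a))).
Proof.
move=> Lc oP v Sv /oP[e [e0 eP]].
exists 1%N, (fun=> L), e; do 2!split => //; move=> w Sw /(_ ord0) h; apply: eP.
move: h; rewrite (norm_lt_emb sc) ltr_norml => h.
have := nrm_tri sc (L v) (L w) a; have := nrm_tri sc (L w) (L v) a.
rewrite (nrmBC sc (L v) (L w)) => ? ?; apply/andP; split; lra.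
Qed.

Lemma weak_open_lt (L : (X -> K) -> K) (r : R) : cont_lin_functional emb S nb L ->
  weak_open emb S nb (fun w => nrm (L w) < r).
Proof.
move=> Lc.
have -> : (fun w => nrm (L w) < r) = (fun w => nrm (L w - 0) < r) :> (_ -> Prop).
  by apply: funext => w; rewrite subr0.
apply: (@weak_open_ball L 0 (fun t => t < r)) => // t tr.
exists (r - t); rewrite subr_gt0; split => // t'; rewrite ltr_norml => /andP[]; lra.
Qed.

Lemma weak_open_gt (L : (X -> K) -> K) (a : K) (r : R) : cont_lin_functional emb S nb L ->
  weak_open emb S nb (fun w => r < nrm (L w - a)).
Proof.
move=> Lc.
apply: (@weak_open_ball L a (fun t => r < t)) => // t tr.
exists (t - r); rewrite subr_gt0; split => // t'; rewrite ltr_norml => /andP[]; lra.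
Qed.

(** * Total boundedness and relative compactness *)

Definition totally_bounded (A : (X -> K) -> Prop) : Prop :=
  forall e : R, 0 < e -> exists s : seq (X -> K), (forall a, List.In a s -> A a) /\
    forall v, A v -> exists a, List.In a s /\ nb (fun t => v t - a t) e.

Definition cauchy_complete : Prop :=
  forall u : nat -> X -> K, (forall n, S (u n)) ->
    (forall e : R, 0 < e -> exists n0, forall m n, (n0 <= m)%N -> (n0 <= n)%N ->
       nb (fun t => u m t - u n t) e) ->
  exists l, S l /\ forall e : R, 0 < e -> exists n0, forall n, (n0 <= n)%N ->
    nb (fun t => u n t - l t) e.

(** The bisection argument: pieces of the closure that admit no finite subcover can be nested with
    diameters tending to 0, and the cover member containing their limit absorbs one of them. The
    topology [op] is only assumed coarser than the norm topology, with closed balls closed, so that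
    the norm and the weak topology are both covered. *)
Lemma rel_compact_of_totally_bounded (op : ((X -> K) -> Prop) -> Prop)
    (A : (X -> K) -> Prop) :
    (forall u v w a b, nb (fun t => u t - v t) a -> nb (fun t => v t - w t) b ->
       nb (fun t => u t - w t) (a + b)) ->
    (forall u v a, nb (fun t => u t - v t) a -> nb (fun t => v t - u t) a) ->
    (forall v a b, nb v a -> a <= b -> nb v b) ->
    cauchy_complete ->
    (forall v, A v -> S v) ->
    (forall U, op U -> norm_open S nb U) ->
    op (fun=> True) ->
    (forall U V, op U -> op V -> op (fun w => U w /\ V w)) ->
    (forall a e, S a -> op (fun w => ~ nb (fun t => w t - a t) e)) ->
    totally_bounded A ->
  rel_compact_in S op A.
Proof.
move=> tri sym mono compl AS opn opT opI opB tbA.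
set C := closure_in S op A.
(* A finite net of [A] is also one of its [op]-closure: a point outside the finitely many closed
   balls has an [op]-neighbourhood that misses them, hence misses [A]. *)
have tbC e : 0 < e -> exists s : seq (X -> K), forall v, C v ->
    exists a, List.In a s /\ nb (fun t => v t - a t) e.
  move=> e0; have [s [sA sP]] := tbA e e0; exists s => v [Sv vP].
  apply: contrapT => no.
  have opF (l : seq (X -> K)) : (forall a, List.In a l -> A a) ->
      op (fun w => forall a, List.In a l -> ~ nb (fun t => w t - a t) e).
    elim: l => [|b l IH] lA.
      by congr op: opT; apply: funext => w; apply: propext; split.
    have := opI _ _ (opB b e (AS _ (lA b (or_introl erefl))))
      (IH (fun a al => lA a (or_intror al))).
    congr op; apply: funext => w; apply: propext; split.
      by move=> [h1 h2] a [<-//|/h2].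
    by move=> h; split=> [|a al]; apply: h; [left|right].
  have [|w [Aw wP]] := vP _ (opF s sA).
    by move=> a al nba; apply: no; exists a.
  have [a [al nba]] := sP w Aw; exact: (wP a al).
move=> I U opU cov; apply: contrapT => nofin.
pose fin (D : (X -> K) -> Prop) :=
  exists n (j : 'I_n -> I), forall x, D x -> exists k, U (j k) x.
have finU (D1 D2 D : (X -> K) -> Prop) : fin D1 -> fin D2 ->
    (forall x, D x -> D1 x \/ D2 x) -> fin D.
  move=> [n1 [j1 h1]] [n2 [j2 h2]] h.
  exists (n1 + n2)%N, (fun i => match split i with inl j => j1 j | inr j => j2 j end).
  move=> x /h[/h1[k Uk]|/h2[k Uk]].
    by exists (lshift n2 k); rewrite (unsplitK (inl k)).
  by exists (rshift n1 k); rewrite (unsplitK (inr k)).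
pose small e (D : (X -> K) -> Prop) := forall x y, D x -> D y ->
  nb (fun t => x t - y t) e.
pose bad D := (forall x, D x -> C x) /\ ~ fin D.
have split_bad n (D : {D | bad D}) : exists D' : {D | bad D},
    (forall x, sval D' x -> sval D x) /\ small n.+1%:R^-1 (sval D').
  case: D => D [DC nD] /=; apply: contrapT => no.
  have e0 : 0 < (n.+1%:R^-1 : R) / 2 by rewrite divr_gt0 // invr_gt0.
  have [s sP] := tbC _ e0.
  apply: nD.
  have fs (l : seq (X -> K)) : fin (fun x => D x /\ exists a, List.In a l /\
      nb (fun t => x t - a t) (n.+1%:R^-1 / 2)).
    elim: l => [|b l IH].
      exists 0%N, (fun i : 'I_0 => False_rect I (notF (ltn_ord i))).
      by move=> x [_ [a [[]]]].
    pose Db x := D x /\ nb (fun t => x t - b t) (n.+1%:R^-1 / 2).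
    have fb : fin Db.
      apply: contrapT => nfb; apply: no.
      have bD : bad Db by split => // x [/DC].
      exists (exist _ Db bD); split => /= [x []//|x y [_ hx] [_ hy]].
      by rewrite [_^-1]splitr; apply: tri hx (sym _ _ _ hy).
    apply: finU fb IH _ => x [Dx [a [[<-|al] nba]]]; first by left.
    by right; split => //; exists a.
  have [m [j jP]] := fs s; exists m, j => x Dx; apply: jP; split => //.
  exact/sP/DC.
have [step stepP] := choice (fun p : nat * {D | bad D} => split_bad p.1 p.2).
have badC : bad C by split.
(* [D 0] is the whole closure and has no size bound; the bound [n.+1%:R^-1] belongs to [D n.+1]. *)
pose D := fix D n := if n is m.+1 then step (m, D m) else exist _ C badC.
have Dsub m n : (m <= n)%N -> forall x, sval (D n) x -> sval (D m) x.
  elim: n => [|n IH]; first by rewrite leqn0 => /eqP ->.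
  rewrite leq_eqVlt => /orP[/eqP ->//|]; rewrite ltnS => mn x.
  move=> /(stepP (n, D n)).1; exact: IH.
have Dsmall n : small n.+1%:R^-1 (sval (D n.+1)) := (stepP (n, D n)).2.
have Dne n : exists x, sval (D n) x.
  apply: contrapT => no; apply: (svalP (D n)).2.
  exists 0%N, (fun i : 'I_0 => False_rect I (notF (ltn_ord i))).
  by move=> x Dx; case: no; exists x.
have [w wP] := choice Dne.
have DC n x : sval (D n) x -> C x by exact: (svalP (D n)).1.
have [|e e0|v [Sv vP]] := compl w.
- by move=> n; exact: (DC _ _ (wP n)).1.
- have [n0 n0P] := exists_natSV_lt e0; exists n0.+1 => m n hm hn.
  apply: mono (ltW n0P); apply: Dsmall; exact: Dsub (wP _).
have close e : 0 < e -> exists n, forall x, sval (D n) x -> nb (fun t => x t - v t) e.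
  move=> e0; have e2 : 0 < e / 2 by lra.
  have [n1 n1P] := vP _ e2; have [n2 n2P] := exists_natSV_lt e2.
  exists n2.+1 => x Dx; rewrite [e]splitr.
  apply: tri (mono _ _ _ _ (ltW n2P)) (n1P (maxn n1 n2.+1) (leq_maxl _ _)).
  apply: Dsmall => //; exact: Dsub (leq_maxr _ _) _ (wP _).
have Cv : C v.
  split=> // V opV Vv; have [e [e0 eV]] := opn _ opV v Sv Vv.
  have [n nP] := close e e0; have Cw := DC _ _ (wP n).
  by apply: Cw.2 opV _; apply: eV (nP _ (wP n)); exact: Cw.1.
have [i Uv] := cov v Cv; have [e [e0 eU]] := opn _ (opU i) v Sv Uv.
have [n nP] := close e e0; apply: (svalP (D n)).2.
exists 1%N, (fun=> i) => x Dx; exists ord0; apply: eU (nP _ Dx); exact: (DC _ _ Dx).1.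
Qed.
End Topology.

(** * Lip_0 and the free space *)

Section LipschitzSpaces.
Variables (R : realType) (K : numFieldType) (emb : R -> K).
Variable sc : scalar_structure emb.
Local Notation nrm := (nrm sc).
Variables (M : Type) (d : M -> M -> R) (x0 : M).
Hypothesis hM : is_metric d.
Local Notation LipS := (LipS emb d x0).
Local Notation LipNb := (LipNb emb d).
Local Notation FreeS := (FreeS emb d x0).
Local Notation FreeNb := (FreeNb emb d x0).

Let d_ge0 x y : 0 <= d x y. Proof. by case: hM => ->. Qed.

Lemma lip_leP (g : M -> K) c :
  lip_le emb d g c <-> forall x y, nrm (g x - g y) <= c * d x y.
Proof. by split=> h x y; move: (h x y); rewrite (norm_le_emb sc). Qed.

Lemma lip_le_mono (g : M -> K) a b : lip_le emb d g a -> a <= b -> lip_le emb d g b.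
Proof.
move=> /lip_leP h ab; apply/lip_leP => x y; apply: le_trans (h x y) _.
exact: ler_wpM2r.
Qed.

Lemma lip_leD (g h : M -> K) a b : lip_le emb d g a -> lip_le emb d h b ->
  lip_le emb d (fun t => g t + h t) (a + b).
Proof.
move=> /lip_leP hg /lip_leP hh; apply/lip_leP => x y.
rewrite opprD addrACA mulrDl; apply: le_trans (nrmD _ _ _) _; exact: lerD.
Qed.

Lemma lip_leZ (g : M -> K) a b : lip_le emb d g b ->
  lip_le emb d (fun t => a * g t) (nrm a * b).
Proof.
move=> /lip_leP hg; apply/lip_leP => x y.
by rewrite -mulrBr nrmM -mulrA ler_wpM2l // nrm_ge0.
Qed.

Lemma lip_le_tri (u v w : M -> K) a b : lip_le emb d (fun t => u t - v t) a ->
  lip_le emb d (fun t => v t - w t) b -> lip_le emb d (fun t => u t - w t) (a + b).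
Proof.
move=> h1 h2; have := lip_leD h1 h2; congr lip_le.
by apply: funext => t; rewrite subrKA.
Qed.

Lemma lip_le_sym (u v : M -> K) a : lip_le emb d (fun t => u t - v t) a ->
  lip_le emb d (fun t => v t - u t) a.
Proof.
move=> /(lip_leZ (-1)); rewrite nrmN nrm1 mul1r; congr lip_le.
by apply: funext => t; rewrite mulN1r opprB.
Qed.

Lemma Lip0_nonneg (g : M -> K) : Lip0 emb d x0 g ->
  exists c, 0 <= c /\ lip_le emb d g c.
Proof.
move=> [_ [c hc]]; exists `|c|; split => //; exact: lip_le_mono hc (ler_norm c).
Qed.

Lemma Lip0_0 : Lip0 emb d x0 (fun=> 0).
Proof.
by split=> //; exists 0; apply/lip_leP => x y; rewrite subrr nrm0 mul0r.
Qed.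

Lemma Lip0_lin a (g h : M -> K) : Lip0 emb d x0 g -> Lip0 emb d x0 h ->
  Lip0 emb d x0 (fun t => a * g t + h t).
Proof.
move=> [g0 [c hc]] [h0 [c' hc']]; split; first by rewrite g0 h0 mulr0 addr0.
exists (nrm a * c + c'); exact: lip_leD (lip_leZ _ hc) hc'.
Qed.

Lemma Lip0Z a (g : M -> K) : Lip0 emb d x0 g -> Lip0 emb d x0 (fun t => a * g t).
Proof.
move=> hg; have := Lip0_lin a hg Lip0_0; congr Lip0.
by apply: funext => t; rewrite addr0.
Qed.

Lemma Lip0B (v w : M -> K) : Lip0 emb d x0 v -> Lip0 emb d x0 w ->
  Lip0 emb d x0 (fun t => w t - v t).
Proof.
move=> hv hw; have := Lip0_lin (-1) hv hw; congr Lip0.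
by apply: funext => t; rewrite mulN1r addrC.
Qed.

Lemma eval_diff_functional x y :
  cont_lin_functional emb LipS LipNb (fun v => v x - v y).
Proof.
split=> [a v w _ _|]; first by rewrite mulrBr opprD addrACA.
exists (d x y) => v c _ /lip_leP h; rewrite (norm_le_emb sc) mulrC; exact: h.
Qed.

Lemma eval_functional x : cont_lin_functional emb LipS LipNb (fun v => v x).
Proof.
split=> //; exists (d x x0) => v c [v0 _] /lip_leP h.
by have := h x x0; rewrite (norm_le_emb sc) mulrC v0 subr0.
Qed.

(** The Lipschitz norm is a supremum of moduli of functionals [v x - v y] divided by [d x y], so one
    pair [x], [y] witnesses that [v] is outside the ball, and keeps doing so nearby. *)
Lemma Lip_ball_compl_weak_open (a : M -> K) e : LipS a ->
  weak_open emb LipS LipNb (fun w => ~ LipNb (fun t => w t - a t) e).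
Proof.
move=> Sa v Sv Hv.
have [x [y lt]] : exists x y, e * d x y < nrm (v x - v y - (a x - a y)).
  apply: contrapT => no; apply: Hv; apply/lip_leP => x y.
  rewrite leNgt; apply/negP => lt; apply: no; exists x, y.
  by have -> : v x - v y - (a x - a y) = v x - a x - (v y - a y) by ring.
have [n [L [r [r0 [Lc LU]]]]] := @weak_open_gt _ _ _ sc _ _ _ _ (a x - a y) (e * d x y)
  (eval_diff_functional x y) v Sv lt.
exists n, L, r; do 2!split => //; move=> w Sw /(LU w Sw) lt' /lip_leP h.
have := h x y; rewrite leNgt; apply/negP; rewrite negbK.
suff -> : w x - a x - (w y - a y) = w x - w y - (a x - a y) by [].
by ring.
Qed.

Lemma Lip_complete : cauchy_complete LipS LipNb.
Proof.
move=> u Su uC.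
have [n0 hn0] := uC 1 ltr01.
(* The functions [u n] agree at [x0], so the Cauchy condition bounds [u n x] for each [x]. *)
have pt x : ulim sc (fun n => u n x) (ulimit sc (fun n => u n x)).
  apply: (@ulimitP _ _ _ sc _ (d x x0 + nrm (u n0 x))).
  apply: filterS (omega_ge n0) => m /= hm.
  have /lip_leP/(_ x x0) := hn0 m n0 hm (leqnn _).
  rewrite (Su m).1 (Su n0).1 subrr subr0 mul1r => h.
  by have := nrmD sc (u m x - u n0 x) (u n0 x); rewrite subrK; lra.
pose l x := ulimit sc (fun n => u n x).
have cl e : 0 < e -> exists n0, forall n, (n0 <= n)%N ->
    LipNb (fun t => u n t - l t) e.
  move=> e0; have [n1 hn1] := uC e e0; exists n1 => n hn.
  apply/lip_le_sym/lip_leP => x y.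
  have H : ulim sc (fun m => -1 * (u m y - u n y) + (u m x - u n x))
      (-1 * (l y - u n y) + (l x - u n x)).
    have sh z : ulim sc (fun m => u m z - u n z) (l z - u n z).
      move=> e' e'0; apply: filterS (pt z e' e'0) => m /=.
      by have -> : u m z - u n z - (l z - u n z) = u m z - l z by ring.
    exact: ulim_linear.
  have := @ulim_le _ _ _ sc _ _ 0 (e * d x y) H.
  rewrite !subr0 mulN1r addrC; apply; apply: filterS (omega_ge n1) => m /= hm.
  by have /lip_leP/(_ x y) := hn1 m n hm hn; rewrite subr0 mulN1r addrC.
exists l; split => //; split.
  apply: (ulim_unique (pt x0)).
  by under eq_fun do rewrite (Su _).1; exact: ulim_cst.
have [n1 hn1] := cl 1 ltr01; have [_ [c hc]] := Su n1.
exists (1 + c); have := lip_leD (lip_le_sym (hn1 n1 (leqnn _))) hc; congr lip_le.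
by apply: funext => t; rewrite subrK.
Qed.

(** * Functionals on Lip_0 and the free space *)

Lemma dual_leP (phi : (M -> K) -> K) c : dual_le emb d x0 phi c <->
  forall g, Lip0 emb d x0 g -> lip_le emb d g 1 -> nrm (phi g) <= c.
Proof. by split=> h g h1 h2; move: (h g h1 h2); rewrite (norm_le_emb sc). Qed.

Lemma dual_le_mono phi a b : dual_le emb d x0 phi a -> a <= b -> dual_le emb d x0 phi b.
Proof. by move=> /dual_leP h ab; apply/dual_leP => g h1 h2; exact: le_trans (h g h1 h2) ab. Qed.

Lemma dual_leD phi psi a b : dual_le emb d x0 phi a -> dual_le emb d x0 psi b ->
  dual_le emb d x0 (fun g => phi g + psi g) (a + b).
Proof.
move=> /dual_leP hg /dual_leP hh; apply/dual_leP => g h1 h2.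
by apply: le_trans (nrmD _ _ _) _; apply: lerD; [exact: hg|exact: hh].
Qed.

Lemma dual_leZ phi a b : dual_le emb d x0 phi b ->
  dual_le emb d x0 (fun g => a * phi g) (nrm a * b).
Proof.
move=> /dual_leP hg; apply/dual_leP => g h1 h2.
by rewrite nrmM ler_wpM2l ?nrm_ge0 // hg.
Qed.

Lemma dual_le_tri (u v w : (M -> K) -> K) a b : dual_le emb d x0 (fun t => u t - v t) a ->
  dual_le emb d x0 (fun t => v t - w t) b -> dual_le emb d x0 (fun t => u t - w t) (a + b).
Proof.
move=> h1 h2; have := dual_leD h1 h2; congr dual_le.
by apply: funext => t; rewrite subrKA.
Qed.

Lemma dual_le_sym (u v : (M -> K) -> K) a : dual_le emb d x0 (fun t => u t - v t) a ->
  dual_le emb d x0 (fun t => v t - u t) a.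
Proof.
move=> /(dual_leZ (-1)); rewrite nrmN nrm1 mul1r; congr dual_le.
by apply: funext => t; rewrite mulN1r opprB.
Qed.

Lemma dual0 phi : in_dual emb d x0 phi -> phi (fun=> 0) = 0.
Proof.
move=> [lin _]; apply: (addIr (phi (fun=> 0))); rewrite add0r.
rewrite -{1}[phi (fun=> 0)]mul1r -(lin _ _ _ Lip0_0 Lip0_0); congr phi.
by apply: funext => t; rewrite mulr0 addr0.
Qed.

Lemma dualZ phi a g : in_dual emb d x0 phi -> Lip0 emb d x0 g ->
  phi (fun t => a * g t) = a * phi g.
Proof.
move=> dphi Lg; rewrite -[RHS]addr0 -(dual0 dphi) -(dphi.1 _ _ _ Lg Lip0_0).
by congr phi; apply: funext => t; rewrite addr0.
Qed.

Lemma dualB phi g h : in_dual emb d x0 phi -> Lip0 emb d x0 g -> Lip0 emb d x0 h ->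
  phi (fun t => g t - h t) = phi g - phi h.
Proof.
move=> dphi Lg Lh; rewrite addrC -mulN1r -(dphi.1 _ _ _ Lh Lg).
by congr phi; apply: funext => t; rewrite mulN1r addrC.
Qed.

(** Scaling by [C^-1] brings [g] into the unit ball; for [C = 0] the function [g] vanishes because
    it does so at [x0]. *)
Lemma dual_bound phi c g C : in_dual emb d x0 phi -> dual_le emb d x0 phi c ->
  Lip0 emb d x0 g -> lip_le emb d g C -> 0 <= C -> nrm (phi g) <= C * c.
Proof.
move=> dphi /dual_leP hphi Lg hg; rewrite le_eqVlt => /orP[/eqP C0|C0].
  have -> : g = fun=> 0.
    apply: funext => x; apply: (@nrm_eq0 _ _ _ sc).
    apply/eqP; rewrite eq_le nrm_ge0 andbT.
    by have /lip_leP/(_ x x0) := hg; rewrite -C0 mul0r Lg.1 subr0.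
  by rewrite (dual0 dphi) nrm0 -C0 mul0r.
have := hphi (fun t => emb C^-1 * g t) (Lip0Z _ Lg) _.
rewrite (dualZ _ dphi Lg) nrmM nrm_emb gtr0_norm ?invr_gt0 // ler_pdivrMl //; apply.
by have := lip_leZ (emb C^-1) hg; rewrite nrm_emb gtr0_norm ?invr_gt0 // mulVf ?gt_eqF.
Qed.

Lemma dual_lin a phi psi : in_dual emb d x0 phi -> in_dual emb d x0 psi ->
  in_dual emb d x0 (fun g => a * phi g + psi g).
Proof.
move=> [l1 [c1 h1]] [l2 [c2 h2]]; split.
  by move=> b g h Lg Lh; rewrite l1 // l2 //; ring.
exists (nrm a * c1 + c2); exact: dual_leD (dual_leZ _ h1) h2.
Qed.

Lemma span_delta_lin a (phi psi : (M -> K) -> K) :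
  in_span_delta phi -> in_span_delta psi -> in_span_delta (fun g => a * phi g + psi g).
Proof.
move=> [n [b [x ->]]] [n' [b' [x' ->]]].
exists (n + n')%N, (fun i => match split i with inl j => a * b j | inr j => b' j end),
  (fun i => match split i with inl j => x j | inr j => x' j end).
apply: funext => g; rewrite big_split_ord /= mulr_sumr; congr (_ + _).
  by apply: eq_bigr => i _; rewrite (unsplitK (inl i)) mulrA.
by apply: eq_bigr => i _; rewrite (unsplitK (inr i)).
Qed.

Lemma delta_span x : in_span_delta (delta x : (M -> K) -> K).
Proof.
exists 1%N, (fun=> 1), (fun=> x); apply: funext => g.
by rewrite big_ord_recl big_ord0 mul1r addr0.
Qed.

Lemma span0 : in_span_delta (fun _ : M -> K => 0).
Proof.
exists 0%N, (fun=> 0), (fun i : 'I_0 => False_rect M (notF (ltn_ord i))).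
by apply: funext => g; rewrite big_ord0.
Qed.

Lemma zero_dual : in_dual emb d x0 (fun=> 0).
Proof.
split=> [*|]; first by rewrite mulr0 addr0.
by exists 0; apply/dual_leP => g _ _; rewrite nrm0.
Qed.

Lemma delta_dual x : in_dual emb d x0 (delta x).
Proof.
split=> //; exists (d x x0); apply/dual_leP => g [g0 _] /lip_leP/(_ x x0).
by rewrite g0 subr0 mul1r.
Qed.

Lemma span_dual (phi : (M -> K) -> K) : in_span_delta phi -> in_dual emb d x0 phi.
Proof.
move=> [n [a [x ->]]]; elim: n a x => [|n IH] a x.
  have -> : (fun g : M -> K => \sum_(i < 0) a i * delta (x i) g) = (fun=> 0).
    by apply: funext => g; rewrite big_ord0.
  exact: zero_dual.
have := dual_lin (a ord0) (delta_dual (x ord0))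
  (IH (fun i => a (lift ord0 i)) (fun i => x (lift ord0 i))); congr in_dual.
by apply: funext => g; rewrite big_ord_recl.
Qed.

Lemma free_of_span phi : in_span_delta phi -> in_free emb d x0 phi.
Proof.
move=> sphi; split=> [|e e0]; first exact: span_dual.
exists phi; split => //.
by apply/dual_leP => g _ _; rewrite subrr nrm0 ltW.
Qed.

Lemma free_lin a phi psi : in_free emb d x0 phi -> in_free emb d x0 psi ->
  in_free emb d x0 (fun g => a * phi g + psi g).
Proof.
move=> [d1 h1] [d2 h2]; split; first exact: dual_lin.
move=> e e0; have a0 := nrm_ge0 sc a.
have e1 : 0 < e / 2 / (nrm a + 1) by rewrite divr_gt0 ?ltr_wpDl //; lra.
have e2 : 0 < e / 2 by lra.
have [p1 [s1 b1]] := h1 _ e1; have [p2 [s2 b2]] := h2 _ e2.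
exists (fun g => a * p1 g + p2 g); split; first exact: span_delta_lin.
have := dual_leD (dual_leZ a b1) b2.
have -> : (fun g => a * (phi g - p1 g) + (psi g - p2 g)) =
  (fun g => a * phi g + psi g - (a * p1 g + p2 g)) by apply: funext => g; ring.
move/dual_le_mono; apply.
have : nrm a * (e / 2 / (nrm a + 1)) <= e / 2.
  by rewrite mulrCA ger_pMr // ler_pdivrMr ?ltr_wpDl // mul1r lerDl.
lra.
Qed.

Lemma freeB phi psi : in_free emb d x0 phi -> in_free emb d x0 psi ->
  in_free emb d x0 (fun g => psi g - phi g).
Proof.
move=> hv hw; have := free_lin (-1) hv hw; congr in_free.
by apply: funext => t; rewrite mulN1r addrC.
Qed.

Lemma eval_free_functional g : Lip0 emb d x0 g ->
  cont_lin_functional emb FreeS FreeNb (fun phi => phi g).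
Proof.
move=> Lg; split=> //; have [C [C0 hC]] := Lip0_nonneg Lg; exists C => phi c [dphi _] h.
by rewrite (norm_le_emb sc); exact: dual_bound dphi h Lg hC C0.
Qed.

Lemma Free_ball_compl_weak_open (a : (M -> K) -> K) e : FreeS a ->
  weak_open emb FreeS FreeNb (fun w => ~ FreeNb (fun t => w t - a t) e).
Proof.
move=> Sa v Sv Hv.
have [g [Lg [g1 lt]]] : exists g, Lip0 emb d x0 g /\ lip_le emb d g 1 /\
    e < nrm (v g - a g).
  apply: contrapT => no; apply: Hv; apply/dual_leP => g Lg g1.
  by rewrite leNgt; apply/negP => lt; apply: no; exists g.
have [n [L [r [r0 [Lc LU]]]]] := @weak_open_gt _ _ _ sc _ _ _ _ (a g) e
  (eval_free_functional Lg) v Sv lt.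
exists n, L, r; do 2!split => //; move=> w Sw /(LU w Sw) lt' /dual_leP h.
by have := h g Lg g1; rewrite leNgt lt'.
Qed.

(** Limits are taken along [omega] at each Lipschitz function. The limit is within [e / 2] of some
    [u n1], which is within [e / 2] of the span of the evaluations. *)
Lemma Free_complete : cauchy_complete FreeS FreeNb.
Proof.
move=> u Su uC.
have pt g : Lip0 emb d x0 g -> ulim sc (fun n => u n g) (ulimit sc (fun n => u n g)).
  move=> Lg; have [n0 hn0] := uC 1 ltr01.
  have [C [C0 hC]] := Lip0_nonneg Lg.
  apply: (@ulimitP _ _ _ sc _ (C + nrm (u n0 g))).
  apply: filterS (omega_ge n0) => m /= hm.
  have := dual_bound (freeB (Su n0) (Su m)).1 (hn0 m n0 hm (leqnn _)) Lg hC C0.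
  by have := nrmD sc (u m g - u n0 g) (u n0 g); rewrite subrK mulr1; lra.
pose l g := ulimit sc (fun n => u n g).
have cl e : 0 < e -> exists n0, forall n, (n0 <= n)%N ->
    FreeNb (fun t => u n t - l t) e.
  move=> e0; have [n1 hn1] := uC e e0; exists n1 => n hn.
  apply/dual_le_sym/dual_leP => g Lg g1; apply: ulim_le (pt g Lg) _.
  apply: filterS (omega_ge n1) => m /= hm.
  by have /dual_leP := hn1 m n hm hn; apply.
exists l; split => //; split.
  split=> [a g h Lg Lh|].
    apply: (ulim_unique (pt _ (Lip0_lin a Lg Lh))).
    under eq_fun do rewrite (Su _).1.1 //.
    exact: ulim_linear (pt g Lg) (pt h Lh).
  have [n1 hn1] := cl 1 ltr01; have [[_ [c hc]] _] := Su n1.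
  exists (1 + c); have := dual_leD (dual_le_sym (hn1 n1 (leqnn _))) hc; congr dual_le.
  by apply: funext => t; rewrite subrK.
move=> e e0; have e2 : 0 < e / 2 by lra.
have [n1 hn1] := cl _ e2; have [_ /(_ _ e2)[psi [spsi hpsi]]] := Su n1.
exists psi; split => //; rewrite [e]splitr.
exact: dual_le_tri (dual_le_sym (hn1 n1 (leqnn _))) hpsi.
Qed.

(** The normalised difference of [delta x] and [delta y]; it is the zero functional for [x = y]. *)
Definition molecule (x y : M) : (M -> K) -> K :=
  fun g => emb (d x y)^-1 * (g x - g y).

Lemma molecule_le x y g c : 0 < d x y -> lip_le emb d g c -> nrm (molecule x y g) <= c.
Proof.
move=> xy /lip_leP h; rewrite nrmM nrm_emb gtr0_norm ?invr_gt0 // ler_pdivrMl //.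
by rewrite mulrC.
Qed.

Lemma molecule_dual_le x y : 0 < d x y -> dual_le emb d x0 (molecule x y) 1.
Proof. by move=> xy; apply/dual_leP => g _; exact: molecule_le. Qed.

Lemma molecule_span x y : in_span_delta (molecule x y).
Proof.
have := span_delta_lin (emb (d x y)^-1)
  (span_delta_lin (-1) (delta_span y) (delta_span x)) span0; congr in_span_delta.
by apply: funext => g; rewrite /molecule /delta addr0 mulN1r addrC.
Qed.

Lemma molecule_free x y : in_free emb d x0 (molecule x y).
Proof. exact: free_of_span (molecule_span x y). Qed.

(** Bounded pointwise null sequences are weak*-null: on the unit ball [phi] is uniformly close to a
    finite combination of evaluations. *)
Lemma free_pointwise_null phi (G : nat -> M -> K) : in_free emb d x0 phi ->
    (forall k, Lip0 emb d x0 (G k) /\ lip_le emb d (G k) 1) ->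
    (forall x (e : R), 0 < e -> exists k0, forall k, (k0 <= k)%N -> nrm (G k x) <= e) ->
  forall e : R, 0 < e -> exists k0, forall k, (k0 <= k)%N -> nrm (phi (G k)) <= e.
Proof.
move=> [_ hphi] G1 Gp e e0; have e2 : 0 < e / 2 by lra.
have [_ [[n [a [x ->]]] /dual_leP hpsi]] := hphi _ e2.
suff [k0 hk0] : exists k0, forall k, (k0 <= k)%N ->
    nrm (\sum_(i < n) a i * delta (x i) (G k)) <= e / 2.
  exists k0 => k /hk0; have := hpsi _ (G1 k).1 (G1 k).2.
  set s := \sum_(i < n) _; have := nrmD sc (phi (G k) - s) s; rewrite subrK; lra.
have {e0} : 0 < e / 2 by []; move: (e / 2) => {e e2 hpsi} e.
elim: n a x e => [|n IH] a x e e0.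
  by exists 0%N => k _; rewrite big_ord0 nrm0 ltW.
have e2 : 0 < e / 2 by lra.
have [k1 hk1] := IH (fun i => a (lift ord0 i)) (fun i => x (lift ord0 i)) _ e2.
have a0 := nrm_ge0 sc (a ord0).
have e1 : 0 < e / 2 / (nrm (a ord0) + 1) by rewrite divr_gt0 ?ltr_wpDl //; lra.
have [k2 hk2] := Gp (x ord0) _ e1.
exists (maxn k1 k2) => k; rewrite geq_max => /andP[/hk1 h1 /hk2 h2].
rewrite big_ord_recl; apply: le_trans (nrmD _ _ _) _; rewrite [e]splitr.
apply: lerD h1; rewrite nrmM /delta.
apply: le_trans (ler_wpM2l a0 h2) _.
by rewrite mulrCA ger_pMr // ler_pdivrMr ?ltr_wpDl // mul1r lerDl.
Qed.
End LipschitzSpaces.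

(** * The composition operator and its preadjoint *)

Section CompositionOperator.
Variables (R : realType) (K : numFieldType) (emb : R -> K).
Variable sc : scalar_structure emb.
Local Notation nrm := (nrm sc).
Local Notation re := (re sc).
Variables (M : Type) (dM : M -> M -> R) (xM : M).
Variables (N : Type) (dN : N -> N -> R) (xN : N) (f : M -> N) (L : R).
Hypotheses (hM : is_metric dM) (hN : is_metric dN).
Hypotheses (L0 : 0 <= L) (fL : forall x y, dN (f x) (f y) <= L * dM x y).
Hypothesis f0 : f xM = xN.
Local Notation LipM := (LipS emb dM xM).
Local Notation LipN := (LipS emb dN xN).
Local Notation LipNbM := (LipNb emb dM).
Local Notation LipNbN := (LipNb emb dN).
Local Notation FreeM := (FreeS emb dM xM).
Local Notation FreeN := (FreeS emb dN xN).
Local Notation FreeNbM := (FreeNb emb dM xM).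
Local Notation FreeNbN := (FreeNb emb dN xN).

Lemma Cf_lip_le (g : N -> K) c : 0 <= c -> lip_le emb dN g c ->
  lip_le emb dM (Cf f g) (c * L).
Proof.
move=> c0 /(lip_leP sc) h; apply/(lip_leP sc) => x y; apply: le_trans (h _ _) _.
by rewrite -mulrA ler_wpM2l.
Qed.

Lemma Cf_Lip0 (g : N -> K) : Lip0 emb dN xN g -> Lip0 emb dM xM (Cf f g).
Proof.
move=> Lg; split; first by rewrite /Cf f0 Lg.1.
by have [c [c0 hc]] := Lip0_nonneg sc hN Lg; exists (c * L); exact: Cf_lip_le.
Qed.

Lemma fhat_span (phi : (M -> K) -> K) : in_span_delta phi -> in_span_delta (fhat f phi).
Proof. by move=> [n [a [x ->]]]; exists n, a, (f \o x). Qed.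

Lemma fhat_dual_le phi c : in_dual emb dM xM phi -> dual_le emb dM xM phi c ->
  dual_le emb dN xN (fhat f phi) (L * c).
Proof.
move=> dphi h; apply/(dual_leP sc) => g Lg g1.
apply: dual_bound dphi h (Cf_Lip0 Lg) _ L0 => //.
by rewrite -[L]mul1r; exact: Cf_lip_le.
Qed.

Lemma fhat_dual phi : in_dual emb dM xM phi -> in_dual emb dN xN (fhat f phi).
Proof.
move=> dphi; split; last by have [_ [c hc]] := dphi; exists (L * c); exact: fhat_dual_le.
by move=> a g h Lg Lh; exact: (dphi.1 a _ _ (Cf_Lip0 Lg) (Cf_Lip0 Lh)).
Qed.

Lemma fhat_free phi : in_free emb dM xM phi -> in_free emb dN xN (fhat f phi).
Proof.
move=> [dphi h]; split=> [|e e0]; first exact: fhat_dual.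
have e1 : 0 < e / (L + 1) by rewrite divr_gt0 // ltr_wpDl.
have [psi [spsi hpsi]] := h _ e1; exists (fhat f psi); split; first exact: fhat_span.
have dd : in_dual emb dM xM (fun g => phi g - psi g).
  have := dual_lin sc (-1) (span_dual sc dM xM spsi) dphi; congr in_dual.
  by apply: funext => g; rewrite mulN1r addrC.
apply: dual_le_mono (fhat_dual_le dd hpsi) _ => //.
by rewrite mulrCA ger_pMr // ler_pdivrMr ?ltr_wpDl // mul1r lerDl.
Qed.

(** The net is taken in the finitely many bounded coordinates given by molecules between points of
    [F]. For a pair that [f] does not flatten, the increment of [h = g - g'] is estimated by a
    detour through points [z], [z'] of [F]. *)
Lemma Cf_totally_bounded : finitely_flat dM dN f ->
  totally_bounded LipNbM (image_ball LipN LipNbN (Cf f)).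
Proof.
move=> flat e e0; have [m0 mE mC mT] := hM; have [d0 dE dC dT] := hN.
have e8 : 0 < e / 8 by lra.
have [F HF] := flat _ e8.
pose B (g : N -> K) := LipN g /\ LipNbN g 1.
(* [L + e / 4] bounds [dN z z'] relative to [dM x y], each end of the detour adding [e / 8]. The
   tolerance makes the middle part of the increment [e / 2]; the ends give [e / 4] each, as [h] is
   2-Lipschitz. *)
have D0 : 0 < L + e / 4 by have := L0; lra.
have eta0 : 0 < e / 2 / (L + e / 4) by rewrite divr_gt0 //; lra.
have [|s [sB sP]] := @finite_net _ _ _ sc (N -> K) (N * N) (List.list_prod F F)
    (fun p => molecule emb dN p.1 p.2) (fun=> 1) B _ _ eta0.
  move=> [z z'] g _ [_ g1] /=.
  have [dz|dz] := eqVneq (dN z z') 0.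
    by rewrite /molecule dz invr0 (emb0 sc) mul0r nrm0.
  by apply: molecule_le => //; rewrite lt_neqAle eq_sym dz d0.
exists (map (Cf f) s); split.
  by move=> _ /List.in_map_iff[g [<- /sB[Lg g1]]]; exists g.
move=> _ [g [Lg [g1 ->]]]; have [g' [sg' close]] := sP g (conj Lg g1).
exists (Cf f g'); split; first exact: List.in_map.
have [_ g1'] := sB g' sg'.
pose h t := g t - g' t.
have h2 x y : nrm (h x - h y) <= 2 * dN x y.
  have -> : h x - h y = (g x - g y) - (g' x - g' y) by rewrite /h; ring.
  apply: le_trans (nrmB _ _ _) _.
  by have /(lip_leP sc)/(_ x y) := g1; have /(lip_leP sc)/(_ x y) := g1'; lra.
have hF z z' : List.In z F -> List.In z' F ->
    nrm (h z - h z') <= e / 2 / (L + e / 4) * dN z z'.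
  move=> zF zF'; have [dz|dz] := eqVneq (dN z z') 0.
    by have := h2 z z'; rewrite dz !mulr0.
  have dz0 : 0 < dN z z' by rewrite lt_neqAle eq_sym dz d0.
  have := close (z, z') (List.in_prod _ _ _ _ zF zF').
  rewrite /molecule /= -mulrBr nrmM nrm_emb gtr0_norm ?invr_gt0 // ler_pdivrMl //.
  rewrite [dN z z' * _]mulrC.
  by have -> : h z - h z' = g z - g z' - (g' z - g' z') by rewrite /h; ring.
apply/(lip_leP sc) => x y; rewrite /Cf -!/(h _).
have xy0 := m0 x y.
have [near|[[z [zF hz]] [z' [zF' hz']]]] := HF x y.
  by apply: le_trans (h2 _ _) _; nra.
have t1 := nrm_tri sc (h z) (h (f x)) (h (f y)).
have t2 := nrm_tri sc (h z') (h z) (h (f y)).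
have b1 := h2 (f x) z; have b2 := h2 z' (f y); rewrite (dC z' (f y)) in b2.
have zz : dN z z' <= (L + e / 4) * dM x y.
  have := dT z (f x) z'; have := dT (f x) (f y) z'; have := fL x y.
  rewrite (dC z (f x)); nra.
have b3 : nrm (h z - h z') <= e / 2 * dM x y.
  apply: le_trans (hF z z' zF zF') _.
  apply: le_trans (ler_wpM2l (ltW eta0) zz) _.
  by rewrite mulrA divfK // gt_eqF.
lra.
Qed.

(* Schauder's argument. *)
Lemma fhat_totally_bounded :
  totally_bounded LipNbM (image_ball LipN LipNbN (Cf f)) ->
  totally_bounded FreeNbN (image_ball FreeM FreeNbM (fhat f)).
Proof.
move=> tb e e0; have e6 : 0 < e / 6 by lra.
have e3 : 0 < e / 3 by lra.
have [l [lI lP]] := tb _ e6.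
have lL k : List.In k l -> LipM k /\ LipNbM k L.
  move=> /lI[g [Lg [g1 ->]]]; split; first exact: Cf_Lip0.
  by rewrite -[L]mul1r; exact: Cf_lip_le.
pose B (phi : (M -> K) -> K) := FreeM phi /\ FreeNbM phi 1.
(* The roles are exchanged: the net [l] of the image under [C_f] now supplies the coordinates, and
   functionals of the unit ball are compared by their values on it. *)
have [|s [sB sP]] := @finite_net _ _ _ sc ((M -> K) -> K) (M -> K) l
    (fun k phi => phi k) (fun=> L) B _ _ e3.
  move=> k phi /lL[Lk k1] [[dphi _] phi1].
  by have := dual_bound sc dphi phi1 Lk k1 L0; rewrite mulr1; exact.
exists (map (fhat f) s); split.
  by move=> _ /List.in_map_iff[g [<- /sB[Lg g1]]]; exists g.
move=> _ [phi [Lphi [phi1 ->]]]; have [psi [spsi close]] := sP phi (conj Lphi phi1).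
exists (fhat f psi); split; first exact: List.in_map.
have [Lpsi psi1] := sB psi spsi.
apply/(dual_leP sc) => g Lg g1; rewrite /fhat.
have [|k [kl kc]] := lP (Cf f g); first by exists g.
have [Lk _] := lL k kl; have Lc := Cf_Lip0 Lg; have := close k kl.
have := dual_bound sc Lphi.1 phi1 (Lip0B sc Lk Lc) kc (ltW e6).
have := dual_bound sc Lpsi.1 psi1 (Lip0B sc Lk Lc) kc (ltW e6).
rewrite (dualB Lphi.1 Lc Lk) (dualB Lpsi.1 Lc Lk).
have := nrm_tri sc (phi k) (phi (Cf f g)) (psi (Cf f g)).
have := nrm_tri sc (psi k) (phi k) (psi (Cf f g)).
rewrite (nrmBC sc (psi k) (psi (Cf f g))); lra.
Qed.

Hypothesis cN : complete_metric dN.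

Lemma compact_ops_of_flat : finitely_flat dM dN f ->
  [/\ compact_op FreeM FreeNbM FreeN FreeNbN (fhat f),
      weakly_compact_op emb FreeM FreeNbM FreeN FreeNbN (fhat f),
      compact_op LipN LipNbN LipM LipNbM (Cf f)
    & weakly_compact_op emb LipN LipNbN LipM LipNbM (Cf f)].
Proof.
move=> flat.
have tbC := Cf_totally_bounded flat.
have tbF := fhat_totally_bounded tbC.
have FS v : image_ball FreeM FreeNbM (fhat f) v -> FreeN v.
  by move=> [phi [Sphi [_ ->]]]; exact: fhat_free.
have LS v : image_ball LipN LipNbN (Cf f) v -> LipM v.
  by move=> [g [Sg [_ ->]]]; exact: Cf_Lip0.
have wF U : weak_open emb FreeN FreeNbN U -> norm_open FreeN FreeNbN U.
  by apply: weak_open_norm_open => //; exact: freeB.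
have wL U : weak_open emb LipM LipNbM U -> norm_open LipM LipNbM U.
  by apply: weak_open_norm_open => //; exact: Lip0B.
have T_weak X (S : (X -> K) -> Prop) nb : weak_open emb S nb (fun=> True).
  by move=> v _ _; exists 0%N, (fun=> fun=> 0), 1; split => //; split => // -[].
have T_norm X (S : (X -> K) -> Prop) (nb : _ -> R -> Prop) : norm_open S nb (fun=> True).
  by move=> v _ _; exists 1.
have RF op := @rel_compact_of_totally_bounded _ _ _ FreeN FreeNbN op _
  (dual_le_tri sc (d:=dN) (x0:=xN)) (dual_le_sym sc (d:=dN) (x0:=xN))
  (dual_le_mono sc (d:=dN) (x0:=xN)) (Free_complete sc hN) FS.
have RL op := @rel_compact_of_totally_bounded _ _ _ LipM LipNbM op _
  (lip_le_tri sc (d:=dM)) (lip_le_sym sc (d:=dM))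
  (lip_le_mono sc hM) (Lip_complete sc (d:=dM) (x0:=xM)) LS.
split.
- apply: RF => // [U V|a e Sa].
    by apply: norm_openI; exact: dual_le_mono.
  by apply: wF; exact: Free_ball_compl_weak_open.
- by apply: RF => // [U V|a e Sa]; [exact: weak_openI|exact: Free_ball_compl_weak_open].
- apply: RL => // [U V|a e Sa].
    by apply: norm_openI; exact: lip_le_mono.
  by apply: wL; exact: Lip_ball_compl_weak_open.
- by apply: RL => // [U V|a e Sa]; [exact: weak_openI|exact: Lip_ball_compl_weak_open].
Qed.

(** * From compactness or continuity back to flatness *)

Lemma escaping_scalar_functions : ~ finitely_flat dM dN f ->
  exists (p q : nat -> M) (c : R) (g : nat -> N -> K),
    [/\ 0 < c, forall n, 0 < dM (p n) (q n),
        forall k, Lip0 emb dN xN (g k) /\ lip_le emb dN (g k) 1,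
        forall z (e : R), 0 < e -> exists k0, forall k, (k0 <= k)%N -> nrm (g k z) <= e
      & forall k m, (k <= m)%N -> c <= re (molecule emb dM (p m) (q m) (Cf f (g k)))].
Proof.
have [d0 dE dC dT] := hN.
move=> /(escaping_of_not_flat hM hN cN)[p [q [c [G [c0 pq [Gl Gc Ge]]]]]].
(* Subtracting the value at [xN] gives a function in Lip_0, changes no increment, and keeps
   pointwise convergence since [G k xN] also tends to 0. *)
exists p, q, c, (fun k z => emb (G k z - G k xN)); split => //.
- move=> k.
  have h : lip_le emb dN (fun z => emb (G k z - G k xN)) 1.
    apply/(lip_leP sc) => x y; rewrite -(embB sc) nrm_emb mul1r.
    have -> : G k x - G k xN - (G k y - G k xN) = G k x - G k y by ring.
    have := Gl k x y; have := Gl k y x; rewrite (dC y x) => ? ?.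
    by rewrite ler_norml; apply/andP; split; lra.
  by split => //; split; [rewrite subrr (emb0 sc)|exists 1].
- move=> z e e0; have e2 : 0 < e / 2 by lra.
  have [k1 h1] := Gc z _ e2; have [k2 h2] := Gc xN _ e2.
  exists (maxn k1 k2) => k; rewrite geq_max => /andP[/h1 a /h2 b].
  by rewrite nrm_emb; apply: le_trans (ler_normB _ _) _; lra.
- move=> k m km; rewrite /molecule /Cf -(embB sc) -(embM sc) re_emb.
  rewrite ler_pdivlMl //.
  have := Ge k m km; rewrite /=; lra.
Qed.

(** The weak* limit of the molecules along [omega] in the dual of Lip_0(M). *)
Definition molecule_limit (p q : nat -> M) (h : M -> K) : K :=
  ulimit sc (fun m => molecule emb dM (p m) (q m) h).

Lemma molecule_limitP (p q : nat -> M) (h : M -> K) :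
  (forall n, 0 < dM (p n) (q n)) -> Lip0 emb dM xM h ->
  ulim sc (fun m => molecule emb dM (p m) (q m) h) (molecule_limit p q h).
Proof.
move=> pq [_ [c hc]]; apply: (@ulimitP _ _ _ sc _ c); apply: filterE => m /=.
exact: molecule_le.
Qed.

Lemma molecule_limit_functional (p q : nat -> M) : (forall n, 0 < dM (p n) (q n)) ->
  cont_lin_functional emb LipM LipNbM (molecule_limit p q).
Proof.
move=> pq; split=> [a v w Lv Lw|].
  apply: ulim_unique (molecule_limitP pq (Lip0_lin sc a Lv Lw)) _.
  have := ulim_linear a (molecule_limitP pq Lv) (molecule_limitP pq Lw).
  by congr ulim; apply: funext => m; rewrite /molecule; ring.
exists 1 => v c Lv hc; rewrite (norm_le_emb sc) mul1r -[molecule_limit _ _ _]subr0.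
apply: ulim_le (molecule_limitP pq Lv) _; apply: filterE => m /=.
by rewrite subr0; exact: molecule_le.
Qed.

Lemma molecule_limit_ge (p q : nat -> M) (h : M -> K) (c : R) (k : nat) :
    (forall n, 0 < dM (p n) (q n)) -> Lip0 emb dM xM h ->
    (forall m, (k <= m)%N -> c <= re (molecule emb dM (p m) (q m) h)) ->
  c <= nrm (molecule_limit p q h).
Proof.
move=> pq Lh H; apply: le_trans (le_trans (ler_norm _) (re_le sc _)).
apply: ulim_re_ge (molecule_limitP pq Lh) _.
by apply: filterS (omega_ge k) => m /=; exact: H.
Qed.

Lemma closure_in_sub X (S : (X -> K) -> Prop) op (A : (X -> K) -> Prop) v :
  S v -> A v -> closure_in S op A v.
Proof. by move=> Sv Av; split => // U _ Uv; exists v. Qed.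

(** The escaping functions are weak*-null, so the weakly open sets where [w (g k)] is smaller than
    [c] cover the free space. Finitely many of them miss the image of every molecule of large index.
    As [op] need only refine the weak topology, this covers compact and weakly compact operators. *)
Lemma flat_of_fhat_rel_compact (op : _ -> Prop) :
    (forall U, weak_open emb FreeN FreeNbN U -> op U) ->
    rel_compact_in FreeN op (image_ball FreeM FreeNbM (fhat f)) ->
  finitely_flat dM dN f.
Proof.
move=> wop cpt; apply: contrapT.
move=> /escaping_scalar_functions[p [q [c [g [c0 pq g1 gp ge]]]]].
have [|v [Sv _]|n [j jP]] := cpt nat (fun k w => nrm (w (g k)) < c).
- move=> k; apply/wop/(weak_open_lt (L := fun w => w (g k))).
  exact: (eval_free_functional sc hN (g1 k).1).
- have c2 : 0 < c / 2 by lra.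
  have [k0 h] := free_pointwise_null Sv g1 gp c2.
  by exists k0; have := h k0 (leqnn _); lra.
pose m := \max_(i < n) j i.
have [|k] := jP (fhat f (molecule emb dM (p m) (q m))).
  apply: closure_in_sub; first exact: (fhat_free (molecule_free sc _ _ _ _)).
  exists (molecule emb dM (p m) (q m)); split; first exact: molecule_free.
  by split => //; exact: molecule_dual_le.
have km : (j k <= m)%N by exact: leq_bigmax.
have := ge _ _ km; rewrite /fhat => h.
rewrite ltNge; apply/negP; rewrite negbK.
exact: le_trans h (le_trans (ler_norm _) (re_le sc _)).
Qed.

(** A cover without finite subcover: nonzero functions are caught at a point where they do not
    vanish, and 0 by smallness of the limit functional. For large [k], [C_f (g k)] is small at
    finitely many given points, yet the limit functional stays at least [c] on it. *)
Lemma flat_of_Cf_rel_compact (op : _ -> Prop) :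
    (forall U, weak_open emb LipM LipNbM U -> op U) ->
    rel_compact_in LipM op (image_ball LipN LipNbN (Cf f)) ->
  finitely_flat dM dN f.
Proof.
move=> wop cpt; apply: contrapT.
move=> /escaping_scalar_functions[p [q [c [g [c0 pq g1 gp ge]]]]].
have Lg k := Cf_Lip0 (g1 k).1.
(* The sets indexed by [Some (x, e)] with [e <= 0] are empty, so every pair may serve as an
   index. *)
pose U (i : option (M * R)) (h : M -> K) : Prop :=
  if i is Some (x, e) then 0 < e /\ e < nrm (h x - 0)
  else nrm (molecule_limit p q h) < c.
have [|h [Sh _]|n [j jP]] := cpt _ U.
- case=> [[x e]|] /=; apply: wop.
    have := weak_open_gt (sc := sc) (a := 0) (r := e) (eval_functional sc dM xM x).
    have [e0|e0] := ltP 0 e.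
      by congr weak_open; apply: funext => w; apply: propext; split=> [//|[]].
    by move=> _ v _ []; rewrite ltNge e0.
  exact: (weak_open_lt (molecule_limit_functional pq)).
- have [[x hx]|no] := pselect (exists x, h x <> 0).
    exists (Some (x, nrm (h x) / 2)) => /=; rewrite subr0.
    suff : 0 < nrm (h x) by move=> ?; split; lra.
    rewrite lt_neqAle nrm_ge0 andbT eq_sym; apply/eqP => /nrm_eq0; exact: hx.
  exists None => /=.
  have -> : h = fun=> 0.
    by apply: funext => x; apply: contrapT => hx; apply: no; exists x.
  have -> : molecule_limit p q (fun=> 0) = 0.
    apply: ulim_unique (molecule_limitP pq (Lip0_0 sc dM xM)) _.
    have := ulim_cst sc 0; congr ulim; apply: funext => m.
    by rewrite /molecule subrr mulr0.
  by rewrite nrm0.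
have [k0 hk0] : exists k0, forall i : 'I_n, if j i is Some (x, e) then
    0 < e -> forall k, (k0 <= k)%N -> nrm (g k (f x)) <= e else True.
  have /choice[b bP] : forall i : 'I_n, exists k0, if j i is Some (x, e) then
      0 < e -> forall k, (k0 <= k)%N -> nrm (g k (f x)) <= e else True.
    move=> i; case: (j i) => [[x e]|]; last by exists 0%N.
    have [e0|e0] := ltP 0 e; last by exists 0%N.
    by have [k1 hk1] := gp (f x) e e0; exists k1.
  exists (\max_(i < n) b i) => i; have := bP i; case: (j i) => [[x e]|//] h e0 k hk.
  by apply: h => //; apply: leq_trans hk; exact: leq_bigmax.
have [|i] := jP (Cf f (g k0)).
  apply: closure_in_sub; first exact: Lg.
  by exists (g k0); split; [exact: (g1 k0).1|split; [exact: (g1 k0).2|]].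
have := hk0 i; case: (j i) => [[x e] h [e0]|_] /=.
  by rewrite subr0 ltNge h.
rewrite ltNge; apply/negP; rewrite negbK.
by apply: (@molecule_limit_ge _ _ _ _ k0) => // m; exact: ge.
Qed.

(** The weak neighbourhood of 0 on which the limit functional is below [c] pulls back to a weak*
    neighbourhood of 0. That contains the weak*-null [g k] for large [k], although the functional is
    at least [c] on [C_f (g k)]. *)
Lemma flat_of_weakstar_weak :
    (forall U, weak_open emb LipM LipNbM U ->
       weakstar_open emb dN xN (fun g => U (Cf f g))) ->
  finitely_flat dM dN f.
Proof.
move=> cont; apply: contrapT.
move=> /escaping_scalar_functions[p [q [c [g [c0 pq g1 gp ge]]]]].
have Lg k := Cf_Lip0 (g1 k).1.
have [|n [phi [e [e0 [phiF H]]]]] :=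
  cont _ (weak_open_lt (sc := sc) (r := c) (molecule_limit_functional pq))
    _ (Lip0_0 sc dN xN).
  have -> : molecule_limit p q (Cf f (fun=> 0)) = 0.
    apply: ulim_unique (molecule_limitP pq (Lip0_0 sc dM xM)) _.
    have := ulim_cst sc 0; congr ulim; apply: funext => m.
    by rewrite /molecule subrr mulr0.
  by rewrite nrm0.
have e2 : 0 < e / 2 by lra.
have /choice[b bP] := fun i => free_pointwise_null (phiF i) g1 gp e2.
pose k0 := \max_(i < n) b i.
suff : nrm (molecule_limit p q (Cf f (g k0))) < c.
  rewrite ltNge; apply/negP; rewrite negbK.
  by apply: (@molecule_limit_ge _ _ _ _ k0) => // m; exact: ge.
apply: H (g1 k0).1 _ => i; rewrite (norm_lt_emb sc) (dual0 sc (phiF i).1) subr0.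
have := bP i k0 (leq_bigmax _); lra.
Qed.

End CompositionOperator.

(** * Helly's theorem and weak* continuity *)

Section Helly.
Variables (R : realType) (K : numFieldType) (emb : R -> K).
Variable sc : scalar_structure emb.
Local Notation nrm := (nrm sc).
Local Notation re := (re sc).
Local Notation im := (im sc).
Variables (M : Type) (d : M -> M -> R) (x0 : M).
Hypothesis hM : is_metric d.

(** Complex conjugation, the identity over the reals. It writes the real Euclidean inner product as
    the real part of a scalar-linear map. *)
Definition conj_scalar (w : K) : K := emb (re w) - ii sc * emb (im w).

Lemma re_conj_mul (w z : K) : re (conj_scalar w * z) = re w * re z + im w * im z.
Proof. by rewrite mulrBl reB (reZ sc) -mulrA (re_ii sc) (imZ sc) opprK. Qed.

Lemma re_sum n (F : 'I_n -> K) : re (\sum_i F i) = \sum_i re (F i).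
Proof. by apply: (big_morph re); [exact: reD|exact: re0]. Qed.

Lemma Lip0_sum n (a : 'I_n -> K) (k : 'I_n -> M -> K) :
  (forall i, Lip0 emb d x0 (k i)) -> Lip0 emb d x0 (fun t => \sum_i a i * k i t).
Proof.
elim: n a k => [|n IH] a k Lk.
  have := Lip0_0 sc d x0; congr Lip0; by apply: funext => t; rewrite big_ord0.
have := Lip0_lin sc (a ord0) (Lk ord0)
  (IH (fun i => a (lift ord0 i)) (fun i => k (lift ord0 i)) (fun i => Lk _)).
by congr Lip0; apply: funext => t; rewrite big_ord_recl.
Qed.

Lemma linear_sum (T : (M -> K) -> K) n (a : 'I_n -> K) (k : 'I_n -> M -> K) :
    (forall b g h, Lip0 emb d x0 g -> Lip0 emb d x0 h ->
       T (fun t => b * g t + h t) = b * T g + T h) ->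
    (forall i, Lip0 emb d x0 (k i)) ->
  T (fun t => \sum_i a i * k i t) = \sum_i a i * T (k i).
Proof.
move=> lin; elim: n a k => [|n IH] a k Lk.
  rewrite big_ord0; under [X in T X]eq_fun do rewrite big_ord0.
  have L0 := Lip0_0 sc d x0; have := lin 1 _ _ L0 L0.
  under [X in T X]eq_fun do rewrite mulr0 addr0.
  by rewrite mul1r => /esym/eqP; rewrite -subr_eq0 addrK => /eqP.
rewrite big_ord_recl -(IH _ (fun i => k (lift ord0 i))) // -lin //.
  by congr T; apply: funext => t; rewrite big_ord_recl.
exact: Lip0_sum.
Qed.

Definition span_ball (C : R) (phi : (M -> K) -> K) : Prop :=
  in_span_delta phi /\ dual_le emb d x0 phi C.

Lemma span_ball0 C : 0 <= C -> span_ball C (fun=> 0).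
Proof. by move=> C0; split; [exact: span0|apply/(dual_leP sc) => *; rewrite nrm0]. Qed.

Lemma span_ballZ C a phi : span_ball 1 phi -> nrm a <= C ->
  span_ball C (fun g => a * phi g).
Proof.
move=> [s h] aC; split; last first.
  by apply: (dual_le_mono sc (dual_leZ sc a h)); rewrite mulr1.
have := span_delta_lin a s (span0 K M); congr in_span_delta.
by apply: funext => g; rewrite addr0.
Qed.

Lemma span_ball_convex C phi psi t : 0 <= t <= 1 -> span_ball C phi -> span_ball C psi ->
  span_ball C (fun g => phi g + emb t * (psi g - phi g)).
Proof.
move=> /andP[t0 t1] [s1 h1] [s2 h2].
have -> : (fun g => phi g + emb t * (psi g - phi g)) =
    (fun g => emb t * psi g + (emb (1 - t) * phi g + 0)).
  by apply: funext => g; rewrite (embB sc) (emb1 sc); ring.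
split.
  exact: span_delta_lin s2 (span_delta_lin _ s1 (span0 K M)).
have z : dual_le emb d x0 (fun=> 0) 0 by apply/(dual_leP sc) => *; rewrite nrm0.
apply: (dual_le_mono sc (dual_leD sc (dual_leZ sc (emb t) h2)
  (dual_leD sc (dual_leZ sc (emb (1 - t)) h1) z))).
rewrite !nrm_emb !ger0_norm ?subr_ge0 //; lra.
Qed.

(** The squared Euclidean distance between the vectors of values of [T] and [phi] on the [k j]. *)
Definition gap n (T : (M -> K) -> K) (k : 'I_n -> M -> K) (phi : (M -> K) -> K) : R :=
  \sum_j (re (T (k j) - phi (k j)) ^+ 2 + im (T (k j) - phi (k j)) ^+ 2).

(** If no molecule reached [b / C] in modulus on [k], then [k] would have Lipschitz constant [b / C]
    and [T k] modulus at most [b]. For negative [b] the zero functional serves. *)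
Lemma norming_molecule (C b : R) (T : (M -> K) -> K) (k : M -> K) :
    0 < C ->
    (forall v c, 0 <= c -> Lip0 emb d x0 v -> lip_le emb d v c -> nrm (T v) <= C * c) ->
    Lip0 emb d x0 k -> b < re (T k) ->
  exists psi, span_ball C psi /\ b <= re (psi k).
Proof.
move=> C0 TC Lk lt; have [d0 dE _ _] := hM.
have [b0|b0] := ltP b 0.
  by exists (fun=> 0); rewrite re0 ltW //; split => //; exact/span_ball0/ltW.
have [x [y [xy h]]] : exists x y, 0 < d x y /\ b * d x y <= C * nrm (k x - k y).
  apply: contrapT => no.
  have hk : lip_le emb d k (b / C).
    apply/(lip_leP sc) => x y; rewrite mulrAC ler_pdivlMr //.
    have [exy|dxy] := eqVneq (d x y) 0.
      by have -> := (dE x y).1 exy; rewrite subrr nrm0 (dE y y).2 // mul0r mulr0.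
    rewrite mulrC leNgt; apply/negP => lt'; apply: no; exists x, y.
    by rewrite ltW // lt_neqAle eq_sym dxy d0.
  have := TC k _ (divr_ge0 b0 (ltW C0)) Lk hk; rewrite mulrC divfK ?gt_eqF //.
  have := le_trans (ler_norm _) (re_le sc (T k)); lra.
pose z := molecule emb d x y k.
(* The unimodular [u] rotates the value of the molecule onto the nonnegative reals. *)
have [u [u1 uz]] : exists u, nrm u = 1 /\ u * z = emb (nrm z).
  have [->|z0] := eqVneq z 0; first by exists 1; rewrite nrm1 mulr0 nrm0 (emb0 sc).
  exists (`|z| / z); rewrite divfK // (normE sc); split => //.
  rewrite -(normE sc); apply: (emb_inj sc); rewrite -(normE sc) (emb1 sc).
  by rewrite normrM normfV normr_id divff // normr_eq0.
exists (fun g => emb C * u * molecule emb d x y g); split.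
  apply: span_ballZ; last by rewrite nrmM nrm_emb u1 mulr1 gtr0_norm.
  by split; [exact: molecule_span|exact: molecule_dual_le].
rewrite -/z -mulrA uz -(embM sc) re_emb /z /molecule nrmM nrm_emb.
by rewrite gtr0_norm ?invr_gt0 // mulrCA ler_pdivlMl // mulrC.
Qed.

(* Helly's theorem, by minimising the distance over the convex set [span_ball C]:
   as long as the gap is at least [e ^+ 2], moving towards a norming molecule
   decreases it by a fixed amount. *)
Lemma helly (C e : R) n (T : (M -> K) -> K) (k : 'I_n -> M -> K) :
    0 < C -> 0 < e ->
    (forall a g h, Lip0 emb d x0 g -> Lip0 emb d x0 h ->
       T (fun t => a * g t + h t) = a * T g + T h) ->
    (forall v c, 0 <= c -> Lip0 emb d x0 v -> lip_le emb d v c -> nrm (T v) <= C * c) ->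
    (forall j, Lip0 emb d x0 (k j)) ->
  exists phi, span_ball C phi /\ forall j, nrm (T (k j) - phi (k j)) <= e.
Proof.
move=> C0 e0 lin TC Lk.
have /choice[b bP] := fun j => Lip0_nonneg sc hM (Lk j).
(* A gap of at most [eta] leaves real and imaginary parts at most [e / 2] each. *)
pose eta := (e / 2) ^+ 2.
have eta0 : 0 < eta by rewrite exprn_gt0 // divr_gt0.
(* Two elements of the ball differ on [k j] by at most [2 * (C * b j)], and the squares of both
   parts add up to [8 * (C * b j) ^+ 2]. The summand [eta] makes [Delta] positive and the step [t]
   below at most 1. *)
pose Delta := eta + \sum_j (8 * (C * b j) ^+ 2).
have S0 : 0 <= \sum_j (8 * (C * b j) ^+ 2).
  by apply: sumr_ge0 => j _; rewrite mulr_ge0 ?sqr_ge0.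
have Delta0 : 0 < Delta by rewrite ltr_pwDl.
pose t := eta / (2 * Delta).
have t0 : 0 < t by apply: divr_gt0 => //; exact: mulr_gt0.
have t01 : 0 <= t <= 1.
  rewrite (ltW t0) ler_pdivrMr ?mul1r; last exact: mulr_gt0.
  by rewrite /Delta; move: (\sum_j _) S0 => S S0; lra.
have descent phi : span_ball C phi -> eta < gap T k phi ->
    exists psi, span_ball C psi /\ gap T k psi <= gap T k phi - t * eta / 2.
  move=> sphi big; have dphi := span_dual sc d x0 sphi.1.
  pose w j := T (k j) - phi (k j).
  (* [kw] represents the gradient of the gap: the real part of [T kw - phi kw] is the gap itself. *)
  pose kw x := \sum_j conj_scalar (w j) * k j x.
  have Lkw : Lip0 emb d x0 kw by exact: Lip0_sum.
  have Tkw : T kw = \sum_j conj_scalar (w j) * T (k j) by exact: linear_sum.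
  have phikw : phi kw = \sum_j conj_scalar (w j) * phi (k j).
    by apply: linear_sum => //; exact: dphi.1.
  have gapE : gap T k phi = re (T kw) - re (phi kw).
    rewrite Tkw phikw !re_sum -sumrB; apply: eq_bigr => j _.
    by rewrite !re_conj_mul /w reB imB; ring.
  (* Giving up half of the gap leaves [re (psi kw) - re (phi kw) >= eta / 2]. The linear gain is
     then at least [t * eta] and the quadratic loss at most [t ^+ 2 * Delta = t * eta / 2]. *)
  have [|psi [spsi hpsi]] := @norming_molecule C (re (T kw) - gap T k phi / 2) T kw C0 TC Lkw.
    by have := eta0; lra.
  have dpsi := span_dual sc d x0 spsi.1.
  exists (fun g => phi g + emb t * (psi g - phi g)); split.
    exact: span_ball_convex t01 sphi spsi.
  have psikw : psi kw = \sum_j conj_scalar (w j) * psi (k j).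
    by apply: linear_sum => //; exact: dpsi.1.
  pose v j := psi (k j) - phi (k j).
  have -> : gap T k (fun g => phi g + emb t * (psi g - phi g)) =
      gap T k phi - 2 * t * (re (psi kw) - re (phi kw)) +
      t ^+ 2 * \sum_j (re (v j) ^+ 2 + im (v j) ^+ 2).
    rewrite psikw phikw !re_sum -sumrB !mulr_sumr -sumrB -big_split /=.
    apply: eq_bigr => j _; rewrite !re_conj_mul.
    have -> : T (k j) - (phi (k j) + emb t * (psi (k j) - phi (k j))) =
      w j - emb t * v j by rewrite /w /v; ring.
    rewrite -/(w j) reB imB (reZ sc) (imZ sc) /v !reB !imB; ring.
  have vD : \sum_j (re (v j) ^+ 2 + im (v j) ^+ 2) <= Delta.
    apply: le_trans (_ : \sum_j (8 * (C * b j) ^+ 2) <= _); last by rewrite lerDr ltW.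
    apply: ler_sum => j _; have [b0 hb] := bP j.
    have h1 := dual_bound sc dphi sphi.2 (Lk j) hb b0.
    have h2 := dual_bound sc dpsi spsi.2 (Lk j) hb b0.
    have h3 := nrmB sc (psi (k j)) (phi (k j)); rewrite -/(v j) in h3.
    have r : `|re (v j)| <= 2 * (C * b j) by have := re_le sc (v j); lra.
    have i : `|im (v j)| <= 2 * (C * b j) by have := im_le sc (v j); lra.
    have r2 : re (v j) ^+ 2 <= (2 * (C * b j)) ^+ 2.
      by rewrite -real_normK ?num_real // ler_sqr ?nnegrE // mulr_ge0 // mulr_ge0 // ltW.
    have i2 : im (v j) ^+ 2 <= (2 * (C * b j)) ^+ 2.
      by rewrite -real_normK ?num_real // ler_sqr ?nnegrE // mulr_ge0 // mulr_ge0 // ltW.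
    by move: r2 i2; rewrite exprMn; lra.
  have tD : t ^+ 2 * Delta = t * eta / 2.
    by rewrite /t; field; rewrite gt_eqF.
  have : t ^+ 2 * \sum_j (re (v j) ^+ 2 + im (v j) ^+ 2) <= t * eta / 2.
    by rewrite -tD ler_wpM2l // sqr_ge0.
  have : eta <= 2 * (re (psi kw) - re (phi kw)) by lra.
  move=> /(ler_wpM2l (ltW t0)); lra.
pose E : set R := [set r | exists phi, span_ball C phi /\ r = gap T k phi].
have Elb : has_lbound E.
  exists 0 => _ [phi [_ ->]]; apply: sumr_ge0 => j _.
  by rewrite addr_ge0 ?sqr_ge0.
have E0 : E !=set0.
  by exists (gap T k (fun=> 0)), (fun=> 0); split => //; exact/span_ball0/ltW.
have te : 0 < t * eta / 2 by apply: divr_gt0 => //; exact: mulr_gt0.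
(* A near-minimiser, closer to the infimum than one descent step, admits no further descent. *)
have [_ [phi [sphi ->]] lt] := inf_adherent te (conj E0 Elb).
exists phi; split => //.
have small : gap T k phi <= eta.
  rewrite leNgt; apply/negP => /(descent _ sphi)[psi [spsi hpsi]].
  have : inf E <= gap T k psi by apply: ge_inf => //; exists psi.
  lra.
move=> j; apply: le_trans (nrm_le_re_im _ _) _.
have term : re (T (k j) - phi (k j)) ^+ 2 + im (T (k j) - phi (k j)) ^+ 2 <= eta.
  apply: le_trans small; rewrite /gap (bigD1 j) //= lerDl.
  by apply: sumr_ge0 => i _; rewrite addr_ge0 ?sqr_ge0.
have e20 : 0 <= e / 2 by rewrite divr_ge0 // ltW.
have r : `|re (T (k j) - phi (k j))| <= e / 2.
  rewrite -ler_sqr ?nnegrE // real_normK ?num_real //.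
  by apply: le_trans term; rewrite lerDl sqr_ge0.
have i : `|im (T (k j) - phi (k j))| <= e / 2.
  rewrite -ler_sqr ?nnegrE // real_normK ?num_real //.
  by apply: le_trans term; rewrite lerDr sqr_ge0.
lra.
Qed.
End Helly.

Lemma seq_as_family (T : Type) (s : seq T) : exists n (k : 'I_n -> T),
  (forall i, List.In (k i) s) /\ forall x, List.In x s -> exists i, x = k i.
Proof.
elim: s => [|a s [n [k [k1 k2]]]].
  by exists 0%N, (fun i : 'I_0 => False_rect T (notF (ltn_ord i))); split => // -[].
exists n.+1, (fun i => if unlift ord0 i is Some j then k j else a); split.
  by move=> i; case: unliftP => [j _|_]; [right|left].
move=> x [<-|/k2[i ->]]; first by exists ord0; rewrite unlift_none.
by exists (lift ord0 i); rewrite liftK.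
Qed.

(** * Weak* continuity from flatness, and the equivalences *)

Section WeakStarContinuity.
Variables (R : realType) (K : numFieldType) (emb : R -> K).
Variable sc : scalar_structure emb.
Local Notation nrm := (nrm sc).
Variables (M : Type) (dM : M -> M -> R) (xM : M).
Variables (N : Type) (dN : N -> N -> R) (xN : N) (f : M -> N) (L : R).
Hypotheses (hM : is_metric dM) (hN : is_metric dN).
Hypotheses (L0 : 0 <= L) (fL : forall x y, dN (f x) (f y) <= L * dM x y).
Hypothesis f0 : f xM = xN.

(** Helly's theorem matches [T] on a finite net of the image of the ball by some [phi] in the span
    of norm at most [C]. As both are bounded by [C], [fhat f phi] is then close to the composite of
    [T] with [C_f] on the whole ball. *)
Lemma adjoint_functional_free (T : (M -> K) -> K) : finitely_flat dM dN f ->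
  cont_lin_functional emb (LipS emb dM xM) (LipNb emb dM) T ->
  in_free emb dN xN (fun g => T (Cf f g)).
Proof.
move=> flat [lin [C1 TC1]].
have Lc g : Lip0 emb dN xN g -> Lip0 emb dM xM (Cf f g).
  by apply: Cf_Lip0 => //; exact: fL.
pose C := `|C1| + 1.
have C0 : 0 < C by rewrite ltr_wpDl.
have TC v c : 0 <= c -> Lip0 emb dM xM v -> lip_le emb dM v c -> nrm (T v) <= C * c.
  move=> c0 Lv hv; have := TC1 v c Lv hv; rewrite (norm_le_emb sc) => /le_trans; apply.
  by rewrite ler_wpM2r // (le_trans (ler_norm C1)) // lerDl.
split.
  split=> [a g h Lg Lh|]; first exact: (lin a _ _ (Lc g Lg) (Lc h Lh)).
  exists (C * L); apply/(dual_leP sc) => g Lg g1; apply: TC => //; first exact: Lc.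
  by rewrite -[L]mul1r; apply: (Cf_lip_le sc fL).
move=> e e0; have e2 : 0 < e / 2 by lra.
(* Passing to the net costs [e / 4] for [T] and [e / 4] for [phi]; Helly's approximation takes the
   other [e / 2]. *)
have eta0 : 0 < e / (4 * C) by rewrite divr_gt0 ?mulr_gt0.
have [s [sI sP]] := Cf_totally_bounded sc xN hM hN L0 fL flat eta0.
have [n [k [k1 k2]]] := seq_as_family s.
have Lk j : Lip0 emb dM xM (k j) by have [g [Lg [_ ->]]] := sI _ (k1 j); exact: Lc.
have [phi [[sphi hphi] close]] := helly hM C0 e2 lin TC Lk.
exists (fhat f phi); split; first exact: fhat_span.
apply/(dual_leP sc) => g Lg g1; rewrite /fhat.
have [|_ [/k2[j ->] hj]] := sP (Cf f g); first by exists g.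
have dphi := span_dual sc dM xM sphi.
have Ld := Lip0B sc (Lk j) (Lc g Lg).
have a1 := TC _ _ (ltW eta0) Ld hj.
have a2 := dual_bound sc dphi hphi Ld hj (ltW eta0).
rewrite (dualB dphi (Lc g Lg) (Lk j)) in a2.
have linB : T (fun t => Cf f g t - k j t) = T (Cf f g) - T (k j).
  rewrite addrC -mulN1r -(lin _ _ _ (Lk j) (Lc g Lg)).
  by congr T; apply: funext => t; rewrite mulN1r addrC.
rewrite linB in a1.
have eE : C * (e / (4 * C)) = e / 4 by field; rewrite gt_eqF.
rewrite eE in a1; rewrite mulrC eE nrmBC in a2.
have := close j; have := nrm_tri sc (T (k j)) (T (Cf f g)) (phi (Cf f g)).
have := nrm_tri sc (phi (k j)) (T (k j)) (phi (Cf f g)); lra.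
Qed.

Lemma weakstar_weak_of_flat : finitely_flat dM dN f ->
  forall U, weak_open emb (LipS emb dM xM) (LipNb emb dM) U ->
    weakstar_open emb dN xN (fun g => U (Cf f g)).
Proof.
move=> flat U wU g Lg Ug.
have Lc h : Lip0 emb dN xN h -> Lip0 emb dM xM (Cf f h).
  by apply: Cf_Lip0 => //; exact: fL.
have [n [T [e [e0 [Tc TU]]]]] := wU _ (Lc g Lg) Ug.
exists n, (fun i h => T i (Cf f h)), e; split => //; split=> [i|h Lh H].
  exact: adjoint_functional_free.
exact: TU (Lc h Lh) H.
Qed.

Hypothesis cN : complete_metric dN.

Lemma lipfree_tfae_scalars : lipfree_tfae emb dM xM dN xN f.
Proof.
have wF U : weak_open emb (FreeS emb dN xN) (FreeNb emb dN xN) U ->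
    norm_open (FreeS emb dN xN) (FreeNb emb dN xN) U.
  by apply: weak_open_norm_open => //; exact: freeB.
have wL U : weak_open emb (LipS emb dM xM) (LipNb emb dM) U ->
    norm_open (LipS emb dM xM) (LipNb emb dM) U.
  by apply: weak_open_norm_open => //; exact: Lip0B.
(* Each implication of the cycle goes through [finitely_flat]. *)
rewrite /lipfree_tfae; tfae.
- move=> /(flat_of_fhat_rel_compact sc hM hN L0 fL f0 cN wF) flat.
  by have [] := compact_ops_of_flat sc hM hN L0 fL f0 flat.
- move=> /(flat_of_fhat_rel_compact sc hM hN L0 fL f0 cN (fun U => id)) flat.
  by have [] := compact_ops_of_flat sc hM hN L0 fL f0 flat.
- move=> /(flat_of_Cf_rel_compact sc hM hN fL f0 cN wL) flat.
  by have [] := compact_ops_of_flat sc hM hN L0 fL f0 flat.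
- move=> /(flat_of_Cf_rel_compact sc hM hN fL f0 cN (fun U => id)).
  exact: weakstar_weak_of_flat.
- move=> /(flat_of_weakstar_weak sc hM hN fL f0 cN) flat.
  by have [] := compact_ops_of_flat sc hM hN L0 fL f0 flat.
Qed.
End WeakStarContinuity.

Theorem theoremB (R : realType)
  (M : Type) (dM : M -> M -> R) (xM : M)
  (N : Type) (dN : N -> N -> R) (xN : N)
  (hM : is_metric dM) (cM : complete_metric dM)
  (hN : is_metric dN) (cN : complete_metric dN)
  (f : M -> N) (hf : lipschitz_map dM dN f) (hf0 : f xM = xN) :
  lipfree_tfae (K:=R) id dM xM dN xN f /\
  lipfree_tfae (K:=R[i]) (fun r : R => (r%:C)%C) dM xM dN xN f.
Proof.
have [L fL] := hf; have [d0 _ _ _] := hM.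
(* The given constant may be negative if [M] is a single point, hence the absolute value. *)
have fL' x y : dN (f x) (f y) <= `|L| * dM x y.
  by apply: le_trans (fL x y) _; rewrite ler_wpM2r // ler_norm.
split; apply: lipfree_tfae_scalars hM hN (normr_ge0 L) fL' hf0 cN.
  exact: real_scalar_structure.
exact: complex_scalar_structure.
Qed.
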